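(* Let $B\in\mathbb{C}^{n_1\times\cdots\times n_m}$ be an $m$-mode tensor, let $1\le k_\ell\le n_\ell$ be integers for $1\le\ell\le m$, and let $\{(P_1^{(j)},\ldots,P_m^{(j)})\}_{j=0}^\infty$ be a sequence generated by the HOOI algorithm (described in the context) from an arbitrary initial $(P_1^{(0)},\ldots,P_m^{(0)})$ with $P_\ell^{(0)}\in\mathrm{St}(k_\ell,n_\ell)$. Let $(P_{*1},\ldots,P_{*m})$ be an accumulation point of this sequence, with the subsequence $\{(P_1^{(j)},\ldots,P_m^{(j)})\}_{j\in\mathbb{I}}$ converging to it ($\mathbb{I}$ an infinite index set), and let $(\widehat P_{*1},\ldots,\widehat P_{*\,m-1})$ be an accumulation point of $\{(P_1^{(j+1)},\ldots,P_{m-1}^{(j+1)})\}_{j\in\mathbb{I}}$. For $1\le\ell\le m$ set $$H_{*\ell}:=H_\ell(P_{*1},\ldots,P_{*\,\ell-1},P_{*\,\ell+1},\ldots,P_{*m}),\qquad \widehat H_{*\ell}:=H_\ell(\widehat P_{*1},\ldots,\widehat P_{*\,\ell-1},P_{*\,\ell+1},\ldots,P_{*m}).$$ Then the following hold. (a) The sequence $\{f(P_1^{(j)},\ldots,P_m^{(j)})\}_{j=0}^\infty$ is monotonically increasing (i.e. nondecreasing) and convergent. (b) For $1\le\ell\le m$, $\widehat H_{*\ell}P_{*\ell}=P_{*\ell}\Lambda_{*\ell}$, where $\Lambda_{*\ell}=P_{*\ell}^{\mathrm H}\widehat H_{*\ell}P_{*\ell}\in\mathbb{C}^{k_\ell\times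 k_\ell}$ is Hermitian and its eigenvalues are the $k_\ell$ largest eigenvalues of $\widehat H_{*\ell}$ (counted with multiplicity). (c) If $\delta_{*\ell}:=\lambda_{k_\ell}(H_{*\ell})-\lambda_{k_\ell+1}(H_{*\ell})>0$ for $1\le\ell\le m-1$, then for each $1\le\ell\le m-1$ there is $Q_{*\ell}\in\mathrm{St}(k_\ell,k_\ell)$ with $\widehat P_{*\ell}=P_{*\ell}Q_{*\ell}$, and for all $1\le\ell\le m$, $H_{*\ell}P_{*\ell}=P_{*\ell}\Lambda_{*\ell}$, where $\Lambda_{*\ell}=P_{*\ell}^{\mathrm H}H_{*\ell}P_{*\ell}$ is Hermitian and its eigenvalues are the $k_\ell$ largest eigenvalues of $H_{*\ell}$. (d) For $1\le\ell\le m$ and $j\ge0$ let $Q_\ell^{(j)}\in\mathrm{St}(k_\ell,k_\ell)$ be an orthonormal polar factor of $[P_\ell^{(j)}]^{\mathrm H}P_{*\ell}$. If $(P_{*1},\ldots,P_{*m})$ is an isolated accumulation point of $\{(P_1^{(j)}Q_1^{(j)},\ldots,P_m^{(j)}Q_m^{(j)})\}_{j=0}^\infty$, and if $\delta_{*\ell}>0$ for $1\le\ell\le m-1$ and also $\delta_{*m}:=\lambda_{k_m}(H_{*m})-\lambda_{k_m+1}(H_{*m})>0$, then the entire sequence $\{(P_1^{(j)}Q_1^{(j)},\ldots,P_m^{(j)}Q_m^{(j)})\}_{j=0}^\infty$ converges to $(P_{*1},\ldots,P_{*m})$. (e) With $\delta_\ell^{(j)}=\lambda_{k_\ell}(H_\ell^{(j)})-\lambda_{k_\ell+1}(H_\ell^{(j)})$,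 for each $1\le\ell\le m$, $$\sum_{j=0}^\infty\delta_\ell^{(j)}\,\big\|\sin\Theta\big(\mathcal R(P_\ell^{(j+1)}),\mathcal R(P_\ell^{(j)})\big)\big\|_{\mathrm F}^2<\infty,\qquad \sum_{j=0}^\infty\delta_\ell^{(j)}\,\frac{\big\|H_\ell^{(j)}P_\ell^{(j)}-P_\ell^{(j)}\Lambda_\ell^{(j)}\big\|_{\mathrm F}^2}{\big\|H_\ell^{(j)}\big\|_{\mathrm F}^2}<\infty,$$ where $\Lambda_\ell^{(j)}=[P_\ell^{(j)}]^{\mathrm H}H_\ell^{(j)}P_\ell^{(j)}$.
   Context: Throughout $m\ge2$. $X^{\mathrm H}$ is the conjugate transpose, $\|\cdot\|_{\mathrm F}$ the Frobenius norm (for tensors: square root of the sum of squared moduli of all entries), $\mathcal R(X)$ the column space. $\mathrm{St}(k,n)=\{P\in\mathbb{C}^{n\times k}: P^{\mathrm H}P=I_k\}$. For Hermitian $A\in\mathbb{C}^{n\times n}$, $\lambda_1(A)\ge\cdots\ge\lambda_n(A)$ are its eigenvalues with multiplicity. Mode multiplication: for $X=[x_{ij}]\in\mathbb{C}^{k\times n_\ell}$, $B\times_\ell X$ is the tensor of size $n_1\times\cdots\times n_{\ell-1}\times k\times n_{\ell+1}\times\cdots\times n_m$ with entries $(B\times_\ell X)_{(i_1\cdots i_m)}=\sum_{j=1}^{n_\ell}x_{i_\ell j}\,b_{i_1\cdots i_{\ell-1}\,j\,i_{\ell+1}\cdots i_m}$. The $\ell$th unfolding $[\,\cdot\,]_{\mathrm{ufd},\ell}$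 of a tensor is the matrix whose columns are the mode-$\ell$ fibers (the $\ell$th subscript varies, all others fixed), arranged in some fixed order (the order is immaterial). Objective: $f(P_1,\ldots,P_m)=\|B\times_1P_1^{\mathrm H}\times_2P_2^{\mathrm H}\cdots\times_mP_m^{\mathrm H}\|_{\mathrm F}^2$ for $P_\ell\in\mathrm{St}(k_\ell,n_\ell)$. For each $\ell$, with $(i_1,\ldots,i_{m-1})=(1,\ldots,\ell-1,\ell+1,\ldots,m)$, define $C_\ell(P_{i_1},\ldots,P_{i_{m-1}})=[B\times_{i_1}P_{i_1}^{\mathrm H}\cdots\times_{i_{m-1}}P_{i_{m-1}}^{\mathrm H}]_{\mathrm{ufd},\ell}\in\mathbb{C}^{n_\ell\times(k_{i_1}\cdots k_{i_{m-1}})}$ and $H_\ell(P_{i_1},\ldots,P_{i_{m-1}})=C_\ell(P_{i_1},\ldots,P_{i_{m-1}})\,C_\ell(P_{i_1},\ldots,P_{i_{m-1}})^{\mathrm H}\in\mathbb{C}^{n_\ell\times n_\ell}$. HOOI algorithm (higher-order orthogonal iteration, run for infinitely many steps): for $j=0,1,2,\ldots$ and, within each $j$, for $\ell=1,2,\ldots,m$ in order, set $H_\ell^{(j)}=H_\ell(P_1^{(j+1)},\ldots,P_{\ell-1}^{(j+1)},P_{\ell+1}^{(j)},\ldots,P_m^{(j)})$ and let $P_\ell^{(j+1)}\in\mathrm{St}(k_\ell,n_\ell)$ be a top $k_\ell$ eigenvector matrix of $H_\ell^{(j)}$, i.e. its columns are orthonormal eigenvectors of $H_\ell^{(j)}$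 associated with its $k_\ell$ largest eigenvalues (any choice if not unique); equivalently, top $k_\ell$ left singular vectors of the corresponding $C_\ell$. Canonical angles: for $X,Y\in\mathrm{St}(k,n)$, $\theta_i=\arccos\sigma_i(X^{\mathrm H}Y)\in[0,\pi/2]$, $1\le i\le k$, where $\sigma_i$ are singular values, and $\|\sin\Theta(\mathcal R(X),\mathcal R(Y))\|_{\mathrm F}=\big(\sum_{i=1}^k\sin^2\theta_i\big)^{1/2}$. An orthonormal polar factor of a matrix $A\in\mathbb{C}^{n\times k}$ ($n\ge k$) is any $Q\in\mathrm{St}(k,n)$ with $A=Q\Gamma$ for some Hermitian positive semidefinite $\Gamma$. An accumulation point of a sequence is a limit of some subsequence; it is isolated if some neighborhood of it contains no other accumulation point of the sequence. Conventions: if $k_\ell=n_\ell$ (so that $\lambda_{k_\ell+1}$ does not exist), the gap condition $\delta_{*\ell}>0$ is regarded as satisfied and the two series in (e) for that $\ell$ are regarded as vacuous (all their factors other than $\delta_\ell^{(j)}$ vanish); a term of the second series in (e) with $H_\ell^{(j)}=0$ is taken to be $0$. *)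

(* Defs.v *)
From HB Require Import structures.
From mathcomp Require Import all_boot all_order all_fingroup all_algebra.
From mathcomp Require Import all_classical all_reals all_analysis.
From mathcomp Require Import complex.
Import Order.TTheory GRing.Theory Num.Theory.
Import numFieldNormedType.Exports.

Set Implicit Arguments.
Unset Strict Implicit.
Unset Printing Implicit Defensive.

Local Open Scope ring_scope.
Local Open Scope classical_set_scope.
Local Open Scope sesquilinear_scope.
Local Open Scope complex_scope.

(* The metric of R[i] is the one of its norm; the library puts it only on the
   alias R[i]^o. *)
HB.instance Definition _ (R : realType) :=
  PseudoMetricNormedZmod.copy R[i] (R[i]^o).

Section Matrices.
Variable R : realType.
Implicit Types n k p : nat.

Definition stiefel k n (P : 'M[R[i]]_(n, k)) : Prop := P^t* *m P = 1%:M.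

Definition hermitian n (A : 'M[R[i]]_n) : Prop := A^t* = A.

Definition psd n (A : 'M[R[i]]_n) : Prop :=
  hermitian A /\ forall x : 'cV[R[i]]_n, 0 <= (x^t* *m A *m x) ord0 ord0.

Definition fro_mx n k (A : 'M[R[i]]_(n, k)) : R :=
  Num.sqrt (\sum_(i < n) \sum_(j < k) Normc.normc (A i j) ^+ 2).

(* Eigenvalues with multiplicity, in nonincreasing order.  Only used on
   Hermitian matrices, where taking real parts loses nothing. *)
Definition eigvals n (A : 'M[R[i]]_n) : seq R :=
  sort (fun x y => y <= x)
    [seq complex.Re z | z <- sval (closed_field_poly_normal (char_poly A))].

(* Numbered from 1: lambda A 1 is the largest eigenvalue. *)
Definition lambda n (A : 'M[R[i]]_n) (i : nat) : R := (eigvals A)`_i.-1.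

Definition sigma n k (A : 'M[R[i]]_(n, k)) (i : nat) : R :=
  Num.sqrt (lambda (A^t* *m A) i).

Definition gap n (A : 'M[R[i]]_n) k : R := lambda A k - lambda A k.+1.

(* When k = n there is no lambda A k.+1 and the condition holds by convention. *)
Definition gap_pos n (A : 'M[R[i]]_n) k : Prop := (k < n)%N -> 0 < gap A k.

(* The permutation is there because the order of the columns is free. *)
Definition top_eigenvectors n (A : 'M[R[i]]_n) k (P : 'M[R[i]]_(n, k)) : Prop :=
  stiefel P /\ exists s : 'S_k,
    A *m P = P *m diag_mx (\row_(i < k) (lambda A (s i).+1)%:C).

Definition rayleigh n (A : 'M[R[i]]_n) k (P : 'M[R[i]]_(n, k)) : 'M[R[i]]_k :=
  P^t* *m A *m P.

Definition top_eigenspace_eq n (A : 'M[R[i]]_n) k (P : 'M[R[i]]_(n, k)) : Prop :=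
  [/\ A *m P = P *m rayleigh A P,
      hermitian (rayleigh A P)
    & eigvals (rayleigh A P) = take k (eigvals A)].

Definition canonical_angle n k (X Y : 'M[R[i]]_(n, k)) (i : nat) : R :=
  acos (sigma (X^t* *m Y) i).

Definition sin_theta n k (X Y : 'M[R[i]]_(n, k)) : R :=
  Num.sqrt (\sum_(1 <= i < k.+1) sin (canonical_angle X Y i) ^+ 2).

Definition polar_factor n k (A Q : 'M[R[i]]_(n, k)) : Prop :=
  stiefel Q /\ exists2 G : 'M[R[i]]_k, psd G & A = Q *m G.

End Matrices.

Section Tensors.
Variables (R : realType) (m : nat).

Definition midx (d : 'I_m -> nat) := {dffun forall l : 'I_m, 'I_(d l)}.

Definition tensor (d : 'I_m -> nat) := {ffun midx d -> R[i]}.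

Definition fro_tensor d (T : tensor d) : R :=
  Num.sqrt (\sum_(i : midx d) Normc.normc (T i) ^+ 2).

(* T x_l X, for sizes d' that agree with d off l: the j in the sum are those
   of the form (i_1, .., i_(l-1), j_l, i_(l+1), .., i_m). *)
Definition mode_mul (d d' : 'I_m -> nat) (l : 'I_m) (X : 'M[R[i]]_(d' l, d l))
    (T : tensor d) : tensor d' :=
  [ffun i : midx d' =>
    \sum_(j : midx d | [forall r, (r != l) ==> (i r == j r :> nat)])
      X (i l) (j l) * T j].

Definition set_dim (k d : 'I_m -> nat) (l : 'I_m) : 'I_m -> nat :=
  fun r => if r == l then k r else d r.

(* T x_l1 (P_l1)^H x_l2 (P_l2)^H .. for s = [:: l1; l2; ..] without repetition.
   conform_mx only transports (P l)^t* along the equalities k l = set_dim k d l l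
   and n l = d l; the latter holds at every step since l has not been used. *)
Fixpoint multi_mul (n k : 'I_m -> nat) (P : forall l, 'M[R[i]]_(n l, k l))
    (s : seq 'I_m) (d : 'I_m -> nat) (T : tensor d) {struct s} :
    tensor (foldl (set_dim k) d s) :=
  match s return tensor (foldl (set_dim k) d s) with
  | [::] => T
  | l :: s' =>
      multi_mul P s' (@mode_mul d (set_dim k d l) l (conform_mx 0 (P l)^t*) T)
  end.

Definition objective n (B : tensor n) k (P : forall l, 'M[R[i]]_(n l, k l)) : R :=
  fro_tensor (multi_mul P (enum 'I_m) B) ^+ 2.

End Tensors.

Arguments tensor R {m} d.

Section Unfolding.
Variables (R : realType) (m : nat).

(* A mode-l fiber is given by the subscripts other than the l-th one. *)
Definition fiber (d : 'I_m -> nat) (l : 'I_m) : finType :=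
  midx (fun r : 'I_m.-1 => d (lift l r)).

Definition fiber_idx (d : 'I_m -> nat) (l : 'I_m) (a : 'I_(d l)) (c : fiber d l) :
    midx d :=
  [ffun r : 'I_m =>
     match unliftP l r with
     | UnliftSome t e => ecast x 'I_(d x) (esym e) (c t)
     | UnliftNone e => ecast x 'I_(d x) (esym e) a
     end].

Definition unfolding (d : 'I_m -> nat) (l : 'I_m) (T : tensor R d) :
    'M[R[i]]_(d l, #|fiber d l|) :=
  \matrix_(a < d l, c < #|fiber d l|) T (fiber_idx a (enum_val c)).

Definition other_modes (l : 'I_m) : seq 'I_m := [seq r <- enum 'I_m | r != l].

(* The component P l is ignored by Cmat and Hmat.  Again conform_mx is a mere
   transport, the l-th size being still n l. *)
Definition Cmat n (B : tensor R n) k (l : 'I_m)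
    (P : forall r, 'M[R[i]]_(n r, k r)) :
    'M[R[i]]_(n l, #|fiber (foldl (set_dim k) n (other_modes l)) l|) :=
  conform_mx 0 (unfolding l (multi_mul P (other_modes l) B)).

Definition Hmat n (B : tensor R n) k (l : 'I_m)
    (P : forall r, 'M[R[i]]_(n r, k r)) : 'M[R[i]]_(n l) :=
  Cmat B l P *m (Cmat B l P)^t*.

End Unfolding.

Section Sequences.

(* Limit of some subsequence (not the library's cluster point of a filter). *)
Definition accumulation_point (T : topologicalType) (u : nat -> T) (x : T) : Prop :=
  exists2 phi : nat -> nat, {homo phi : i j / (i < j)%N} &
    (fun i => u (phi i)) @ \oo --> x.

Definition isolated_accumulation_point (T : topologicalType) (u : nat -> T)
    (x : T) : Prop :=
  accumulation_point u x /\
  exists2 U : set T, nbhs x U & forall y, U y -> accumulation_point u y -> y = x.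

End Sequences.

Section HOOI.
Variables (R : realType) (m : nat) (n k : 'I_m -> nat).

Definition factors : topologicalType :=
  prod_topology (fun l : 'I_m => 'M[R[i]]_(n l, k l)).

Definition mode_but_last := {l : 'I_m | (l < m.-1)%N}.

Definition factors_but_last : topologicalType :=
  prod_topology (fun l : mode_but_last => 'M[R[i]]_(n (sval l), k (sval l))).

Definition drop_last (P : factors) : factors_but_last := fun l => P (sval l).

Definition with_last (P : factors_but_last) (P' : factors) : factors :=
  fun l => match @idP (l < m.-1)%N with
           | ReflectT h => P (exist _ l h)
           | ReflectF _ => P' l
           end.

(* P for the modes before l, P' for the others. *)
Definition before (l : 'I_m) (P P' : factors) : factors :=
  fun r => if (r < l)%N then P r else P' r.

Definition Hseq (B : tensor R n) (P : nat -> factors) (j : nat) (l : 'I_m) :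
    'M[R[i]]_(n l) := Hmat B l (before l (P j.+1) (P j)).

Definition hooi (B : tensor R n) (P : nat -> factors) : Prop :=
  (forall l, stiefel (P 0%N l)) /\
  (forall j l, top_eigenvectors (Hseq B P j l) (P j.+1 l)).

End HOOI.

(* Main.v *)
Require Import Defs.
From mathcomp Require Import all_boot all_order all_fingroup all_algebra.
From mathcomp Require Import all_classical all_reals all_analysis.
From mathcomp Require Import complex ring lra.
Import Order.TTheory GRing.Theory Num.Theory.
Import numFieldNormedType.Exports.
Local Open Scope ring_scope.
Local Open Scope classical_set_scope.
Local Open Scope sesquilinear_scope.
Local Open Scope complex_scope.

Set Implicit Arguments.
Unset Strict Implicit.
Unset Printing Implicit Defensive.

Local Notation hermitian := Defs.hermitian.
Local Notation normc := Normc.normc.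
Local Notation eq0_normc := Normc.eq0_normc.
Local Notation Re := complex.Re.
Local Notation Im := complex.Im.

(* The objective seen from mode l is the trace of P_l^H H_l P_l, so by Ky Fan an
   update maximizes it and the objective increases. In terms of the diagonal of the
   projector on R(P_l), written in an eigenbasis of H_l, the distance of that
   trace to its maximum is a sum of nonnegative terms: their vanishing describes the
   maximizers, and the gap times sin^2 is a lower bound for them, which telescopes.
   Along a subsequence, X = lim P^(j) and Y = lim P^(j+1) have the same objective, and
   so has every intermediate state; hence X_l and Y_l both maximize for
   H_l(Y_1, .., Y_(l-1), X_(l+1), .., X_m), and when the gaps are positive they span
   the same subspace, mode after mode. For the polar-aligned iterates this says that
   a step taken near an isolated accumulation point stays near it. *)

(** * Adjoints and the squared Frobenius norm *)

(** The tensor enters only through the entry formulas [objectiveE] and [HmatE]: the objective and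
    the entries of [H_l] are polynomials in the entries of the matrices [P_r P_r^H]. Hence they are
    continuous and blind to a unitary factor on the right of any [P_r], and the bookkeeping of the
    sizes of partially contracted tensors stays behind these formulas. Continuity of eigenvalues is
    never invoked. A limit of maximizers is shown to be a maximizer by comparing traces with a fixed
    competitor, and the spectral statements are recovered from maximality afterwards. In (b) there
    is no gap, so a maximizer is not determined inside the eigenspace of the k-th eigenvalue;
    shifting the matrix by that eigenvalue makes this eigenspace disappear. In (d) the iterates
    themselves need not converge along a subsequence on which the aligned ones do, and polar factors
    are not continuous in general. They are controlled only in the limit: when the limiting product
    is unitary, its polar factor is forced. *)

Section Adjoint.
Variable R : realType.
Implicit Types p q r : nat.

Lemma adjmxM p q r (A : 'M[R[i]]_(p, q)) (B : 'M[R[i]]_(q, r)) :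
  (A *m B)^t* = B^t* *m A^t*.
Proof. by rewrite trmx_mul map_mxM. Qed.

Lemma adjmxB p q (A B : 'M[R[i]]_(p, q)) : (A - B)^t* = A^t* - B^t*.
Proof. by rewrite linearB map_mxB. Qed.

Lemma adjmxE p q (A : 'M[R[i]]_(p, q)) i j : A^t* i j = (A j i)^*.
Proof. by rewrite !mxE. Qed.

Lemma hermitian_conj p q (A : 'M[R[i]]_p) (X : 'M[R[i]]_(p, q)) :
  hermitian A -> hermitian (X^t* *m A *m X).
Proof. by move=> hA; rewrite /hermitian !adjmxM trmxCK hA mulmxA. Qed.

Lemma normc_sqrE (z : R[i]) : normc z ^+ 2 = Re z ^+ 2 + Im z ^+ 2.
Proof. by case: z => a b /=; rewrite sqr_sqrtr // addr_ge0 ?sqr_ge0. Qed.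

Lemma normc_sqr (z : R[i]) : (normc z ^+ 2)%:C = z * z^*.
Proof. by rewrite rmorphXn /= -sqr_normc; congr (_ ^+ 2); case: z. Qed.

Lemma normc_conj (z : R[i]) : normc z^* = normc z.
Proof. by case: z => a b /=; rewrite sqrrN. Qed.

Lemma normc_ge0 (z : R[i]) : 0 <= normc z.
Proof. by case: z => a b /=; exact: sqrtr_ge0. Qed.

(** Cauchy-Schwarz. The triangle inequality reduces it to moduli, for which Lagrange's identity
    writes the difference of the two sides as half a double sum of squares. *)
Lemma normc_sum_sqr_le (I : finType) (a b : I -> R[i]) :
  normc (\sum_i a i * b i) ^+ 2 <=
    (\sum_i normc (a i) ^+ 2) * (\sum_i normc (b i) ^+ 2).
Proof.
set x := fun i => normc (a i); set y := fun i => normc (b i).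
have le1 : normc (\sum_i a i * b i) <= \sum_i x i * y i.
  elim/big_rec2: _ => [|i u v _ le_uv]; first by rewrite Normc.normc0.
  by rewrite (le_trans (le_normcD _ _)) // Normc.normcM lerD2l.
apply: le_trans (_ : (\sum_i x i * y i) ^+ 2 <= _).
  by rewrite ler_sqr ?nnegrE ?normc_ge0 // sumr_ge0 // => i _; rewrite mulr_ge0 ?normc_ge0.
have : 0 <= \sum_i \sum_j (x i * y j - x j * y i) ^+ 2.
  by apply: sumr_ge0 => i _; apply: sumr_ge0 => j _; exact: sqr_ge0.
have -> : \sum_i \sum_j (x i * y j - x j * y i) ^+ 2 =
   2 * ((\sum_i x i ^+ 2) * (\sum_i y i ^+ 2) - (\sum_i x i * y i) ^+ 2).
  rewrite expr2 !mulr_suml.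
  transitivity (\sum_i \sum_j (x i ^+ 2 * y j ^+ 2 - (x i * y i) * (x j * y j))
     + \sum_i \sum_j (x j ^+ 2 * y i ^+ 2 - (x i * y i) * (x j * y j))).
    rewrite -big_split; apply: eq_bigr => i _ /=; rewrite -big_split.
    by apply: eq_bigr => j _ /=; ring.
  rewrite [in X in _ + X]exchange_big /= mulr_natl mulr2n; congr (_ + _).
    rewrite -sumrB; apply: eq_bigr => i _.
    by rewrite sumrB -!mulr_sumr.
  rewrite -sumrB; apply: eq_bigr => i _.
  rewrite sumrB -!mulr_sumr; congr (_ - _).
  by rewrite mulr_sumr; apply: eq_bigr => j _; ring.
by rewrite pmulr_rge0 // subr_ge0.
Qed.

Definition nsq p q (A : 'M[R[i]]_(p, q)) : R :=
  \sum_i \sum_j normc (A i j) ^+ 2.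

Lemma nsq_ge0 p q (A : 'M[R[i]]_(p, q)) : 0 <= nsq A.
Proof. by apply: sumr_ge0 => i _; apply: sumr_ge0 => j _; exact: sqr_ge0. Qed.

Lemma fro_mx_sqr p q (A : 'M[R[i]]_(p, q)) : fro_mx A ^+ 2 = nsq A.
Proof. by rewrite sqr_sqrtr // nsq_ge0. Qed.

Lemma nsqE p q (A : 'M[R[i]]_(p, q)) : (nsq A)%:C = \tr (A *m A^t*).
Proof.
rewrite rmorph_sum; apply: eq_bigr => i _; rewrite mxE rmorph_sum.
by apply: eq_bigr => j _; rewrite adjmxE; exact: normc_sqr.
Qed.

Lemma nsq_adj p q (A : 'M[R[i]]_(p, q)) : nsq (A^t*) = nsq A.
Proof. by apply: complexI; rewrite !nsqE trmxCK mxtrace_mulC. Qed.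

Lemma nsq0 p q : nsq (0 : 'M[R[i]]_(p, q)) = 0.
Proof. by apply: complexI; rewrite nsqE mul0mx mxtrace0. Qed.

Lemma nsq_eq0 p q (A : 'M[R[i]]_(p, q)) : nsq A = 0 -> A = 0.
Proof.
move/eqP; rewrite psumr_eq0 => [|i _]; last first.
  by apply: sumr_ge0 => j _; exact: sqr_ge0.
move=> /allP h; apply/matrixP => i j; rewrite mxE; apply: eq0_normc.
have /eqP/psumr_eq0P := h i (mem_index_enum _).
by move=> /(_ (fun _ _ => sqr_ge0 _)) /(_ j isT) /eqP; rewrite sqrf_eq0 => /eqP.
Qed.

Lemma nsqM_le p q r (A : 'M[R[i]]_(p, q)) (B : 'M[R[i]]_(q, r)) :
  nsq (A *m B) <= nsq A * nsq B.
Proof.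
rewrite -[nsq B]nsq_adj mulr_suml; apply: ler_sum => i _.
rewrite mulr_sumr; apply: ler_sum => j _; rewrite mxE.
apply: le_trans (normc_sum_sqr_le _ _) _; apply: ler_wpM2l.
  by apply: sumr_ge0 => l _; exact: sqr_ge0.
by apply: ler_sum => l _; rewrite adjmxE normc_conj.
Qed.

Lemma nsqD_le p q (A B : 'M[R[i]]_(p, q)) :
  nsq (A + B) <= 2 * (nsq A + nsq B).
Proof.
rewrite /nsq -big_split mulr_sumr; apply: ler_sum => i _ /=.
rewrite -big_split mulr_sumr; apply: ler_sum => j _ /=; rewrite mxE.
rewrite !normc_sqrE !raddfD /=.
set a := Re _; set b := Re _; set c := Im _; set d := Im _.
have := sqr_ge0 (a - b); have := sqr_ge0 (c - d); nra.
Qed.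

Lemma nsqMl_stiefel p q r (X : 'M[R[i]]_(p, q)) (A : 'M[R[i]]_(q, r)) :
  stiefel X -> nsq (X *m A) = nsq A.
Proof.
move=> hX; apply: complexI; rewrite !nsqE adjmxM mxtrace_mulC mulmxA.
by rewrite -[_ *m X^t* *m X]mulmxA hX mulmx1 mxtrace_mulC.
Qed.

(** Pythagoras for the orthogonal projector [X X^H]: the component of [A] in the range of [X] has
    the same norm as its coordinates [X^H A]. *)
Lemma nsq_coproj p q r (X : 'M[R[i]]_(p, q)) (A : 'M[R[i]]_(p, r)) :
  stiefel X -> nsq (A - X *m (X^t* *m A)) = nsq A - nsq (X^t* *m A).
Proof.
move=> hX; apply: complexI; rewrite rmorphB /= !nsqE adjmxB mulmxBl !mulmxBr.
rewrite !adjmxM trmxCK !linearB /=.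
set t1 := \tr (A *m (A^t* *m X *m X^t*)).
have t1E : t1 = \tr ((X *m X^t*) *m (A *m A^t*)).
  by rewrite [RHS]mxtrace_mulC /t1 !mulmxA.
have -> : \tr (X *m (X^t* *m A) *m A^t*) = t1 by rewrite t1E !mulmxA.
have -> : \tr (X *m (X^t* *m A) *m (A^t* *m X *m X^t*)) = t1.
  rewrite mxtrace_mulC !mulmxA -[_ *m X^t* *m X]mulmxA hX mulmx1.
  by rewrite t1E !mulmxA [RHS]mxtrace_mulC !mulmxA.
have -> : \tr (X^t* *m A *m (A^t* *m X)) = t1.
  by rewrite mxtrace_mulC t1E !mulmxA [RHS]mxtrace_mulC !mulmxA.
by ring.
Qed.

Lemma nsq_adj_stiefel_le p q r (X : 'M[R[i]]_(p, q)) (A : 'M[R[i]]_(p, r)) :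
  stiefel X -> nsq (X^t* *m A) <= nsq A.
Proof. by move=> hX; rewrite -subr_ge0 -nsq_coproj // nsq_ge0. Qed.

Lemma nsq_stiefel p q (X : 'M[R[i]]_(p, q)) : stiefel X -> nsq X = q%:R.
Proof.
move=> hX; apply: complexI; rewrite nsqE mxtrace_mulC hX mxtrace1.
by rewrite rmorph_nat.
Qed.

(** The traces of interest are real; taking the real part places them in the ordered field [R]. *)
Definition retr p (A : 'M[R[i]]_p) : R := Re (\tr A).

End Adjoint.

(** * Spectrum of a Hermitian matrix *)

Section Spectrum.
Variable R : realType.

(** Unique factorization into linear factors. Together with sortedness it lets eigenvalues be
    identified from the characteristic polynomial alone. *)
Lemma eigvals_perm n (A : 'M[R[i]]_n) (s : seq R) :
  char_poly A = \prod_(x <- s) ('X - (x%:C)%:P) -> perm_eq (eigvals A) s.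
Proof.
move=> hA; rewrite /eigvals; case: closed_field_poly_normal => r /= hr.
move: hr; rewrite (monicP (char_poly_monic A)) scale1r hA => hr.
rewrite perm_sort -[s in perm_eq _ s](@mapK _ _ (real_complex R) (@complex.Re R)) //.
apply: perm_map; rewrite perm_sym; apply: prod_XsubC_eq.
by rewrite -hr big_map.
Qed.

Lemma eigvals_eq n (A : 'M[R[i]]_n) (s : seq R) :
  char_poly A = \prod_(x <- s) ('X - (x%:C)%:P) ->
  sorted (fun x y : R => y <= x) s -> eigvals A = s.
Proof.
move=> hA hs; apply: (@sorted_eq _ (fun x y : R => y <= x)) => //.
- by move=> y x z /= h1 h2; exact: le_trans h2 h1.
- by move=> x y /= /andP[h1 h2]; apply/eqP; rewrite eq_le h1 h2.
- by apply: sort_sorted => x y /=; exact: le_total.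
- exact: eigvals_perm.
Qed.

Lemma eigvals_sorted n (A : 'M[R[i]]_n) :
  sorted (fun x y : R => y <= x) (eigvals A).
Proof. by apply: sort_sorted => x y /=; exact: le_total. Qed.

Lemma char_poly_unitary n (A D V : 'M[R[i]]_n) :
  V *m V^t* = 1%:M -> A = V *m D *m V^t* -> char_poly A = char_poly D.
Proof.
move=> hV ->; rewrite /char_poly /char_poly_mx.
set W := map_mx polyC V; set W' := map_mx polyC (V^t*).
have hW : W *m W' = 1%:M by rewrite -map_mxM hV map_mx1.
have -> : 'X%:M - map_mx polyC (V *m D *m V^t*) =
   W *m ('X%:M - map_mx polyC D) *m W'.
  rewrite !map_mxM mulmxBr mulmxBl; congr (_ - _).
  by rewrite mul_mx_scalar -scalemxAl hW scalemx1.
by rewrite !det_mulmx mulrAC -det_mulmx hW det1 mul1r.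
Qed.

Lemma char_poly_diag n (d : 'I_n -> R) :
  char_poly (diag_mx (\row_i (d i)%:C)) =
    \prod_(x <- [seq d i | i <- enum 'I_n]) ('X - (x%:C)%:P).
Proof.
rewrite char_poly_trig ?diag_mx_is_trig // big_map big_enum /=.
by apply: eq_bigr => i _; rewrite !mxE eqxx mulr1n.
Qed.

Definition evalmx n (A : 'M[R[i]]_n) : 'M[R[i]]_n :=
  diag_mx (\row_i (lambda A i.+1)%:C).

(** The spectral theorem gives the eigenvalues in an uncontrolled order. A permutation matrix
    absorbed into [V] puts them in the order of [lambda], so that column i of [V] belongs to
    [lambda A i.+1]. *)
Lemma hermitian_spectral n (A : 'M[R[i]]_n) : hermitian A ->
  exists V : 'M[R[i]]_n, [/\ V^t* *m V = 1%:M, V *m V^t* = 1%:M &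
    A = V *m evalmx A *m V^t*].
Proof.
move=> hA; have hAh : A \is hermsymmx.
  by apply/is_hermitianmxP; rewrite expr0 scale1r hA.
have /orthomx_spectralP := hermitian_normalmx hAh.
have := hermitian_spectral_diag_real hAh.
have := spectral_unitarymx A.
move: (spectralmx A) (spectral_diag A) => U sp hU /mxOverP spR.
rewrite invmx_unitary // => AE.
have U1 : U *m U^t* = 1%:M by apply/unitarymxP.
have U2 : U^t* *m U = 1%:M by apply: mulmx1C.
pose d (i : 'I_n) : R := Re (sp 0 i).
have spE : sp = \row_i (d i)%:C.
  by apply/rowP => i; rewrite mxE /d RRe_real.
have hchar : char_poly A = \prod_(x <- [seq d i | i <- enum 'I_n]) ('X - (x%:C)%:P).
  rewrite -char_poly_diag -spE; apply: (@char_poly_unitary _ _ _ (U^t*)).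
    by rewrite trmxCK.
  by rewrite trmxCK.
have := eigvals_perm hchar.
have sz : size [seq d i | i <- enum 'I_n] == n by rewrite size_map size_enum_ord.
move=> /(@tuple_permP _ _ _ (Tuple sz)) [p hp].
have lamE (i : 'I_n) : lambda A i.+1 = d (p i).
  rewrite /lambda hp /= (nth_map i) ?size_enum_ord // nth_ord_enum.
  by rewrite (tnth_nth 0) /= (nth_map i) ?size_enum_ord // nth_ord_enum.
have lamE' : evalmx A = perm_mx p *m diag_mx sp *m (perm_mx p)^T.
  apply/matrixP => i j; rewrite tr_perm_mx -row_permE -col_permE spE !mxE lamE.
  by rewrite (inj_eq (@perm_inj _ p)).
have P1 : perm_mx p *m (perm_mx p)^T = 1%:M :> 'M[R[i]]_n.
  by rewrite tr_perm_mx -perm_mxM mulgV perm_mx1.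
have P2 : (perm_mx p)^T *m perm_mx p = 1%:M :> 'M[R[i]]_n by exact: mulmx1C.
have P3 : (perm_mx p)^t* = (perm_mx p)^T :> 'M[R[i]]_n.
  by apply/matrixP => i j; rewrite !mxE rmorph_nat.
have P4 : ((perm_mx p)^T)^t* = perm_mx p :> 'M[R[i]]_n by rewrite -P3 trmxCK.
exists (U^t* *m (perm_mx p)^T).
rewrite adjmxM P4 trmxCK.
split.
- by rewrite mulmxA -[_ *m U *m _]mulmxA U1 mulmx1.
- by rewrite mulmxA -[_ *m _ *m perm_mx p]mulmxA P2 mulmx1.
rewrite lamE' !mulmxA -[U^t* *m _ *m perm_mx p]mulmxA P2 mulmx1.
by rewrite -[_ *m _ *m perm_mx p]mulmxA P2 mulmx1.
Qed.

Lemma size_eigvals n (A : 'M[R[i]]_n) : hermitian A -> size (eigvals A) = n.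
Proof.
case/hermitian_spectral => V [V1 V2 AE].
have := eigvals_perm (etrans (char_poly_unitary V2 AE) (char_poly_diag _)).
by move/perm_size ->; rewrite size_map size_enum_ord.
Qed.

Lemma lambda_le n (A : 'M[R[i]]_n) i j : hermitian A ->
  (i <= j)%N -> (j < n)%N -> lambda A j.+1 <= lambda A i.+1.
Proof.
move=> hA ij jn; rewrite /lambda /=.
have tr : transitive (fun x y : R => y <= x) by move=> y x z /= h1 h2; exact: le_trans h2 h1.
have := sorted_leq_nth tr (fun x => lexx x) 0 (eigvals_sorted A).
by move=> /(_ i j); rewrite !inE size_eigvals //; apply => //; exact: leq_ltn_trans jn.
Qed.

End Spectrum.

(** * Maximizers of the trace *)

Section KyFan.
Variable R : realType.

Section Weights.
Variables (n k : nat) (Z : 'M[R[i]]_(n, k)).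
Hypothesis hZ : stiefel Z.

(** For [Z = V^H X], with the eigenvectors as columns of [V], this is the squared norm of the
    projection of the i-th eigenvector onto the range of [X]. *)
Definition weight (i : 'I_n) : R := \sum_j normc (Z i j) ^+ 2.

Lemma weightE i : (Z *m Z^t*) i i = (weight i)%:C.
Proof.
rewrite mxE rmorph_sum; apply: eq_bigr => j _.
by rewrite adjmxE; exact/esym/normc_sqr.
Qed.

Lemma sum_weight : \sum_i weight i = k%:R.
Proof. exact: nsq_stiefel. Qed.

Lemma weight_ge0 i : 0 <= weight i.
Proof. by apply: sumr_ge0 => j _; exact: sqr_ge0. Qed.

(* The diagonal of the identity [Pi *m Pi = Pi] for the projector [Pi]. *)
Lemma weight_idem i :
  weight i ^+ 2 + \sum_(j | j != i) normc ((Z *m Z^t*) i j) ^+ 2 = weight i.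
Proof.
set G := Z *m Z^t*.
have GG : G *m G^t* = G.
  by rewrite /G adjmxM trmxCK mulmxA -[_ *m Z^t* *m Z]mulmxA hZ mulmx1.
have : \sum_j normc (G i j) ^+ 2 = weight i.
  apply: complexI; rewrite -weightE -/G -[in RHS]GG mxE rmorph_sum.
  by apply: eq_bigr => j _; rewrite adjmxE; exact: normc_sqr.
rewrite (bigD1 i) //= weightE normc_sqrE /= expr0n addr0.
by [].
Qed.

Lemma weight_le1 i : weight i <= 1.
Proof.
have := weight_idem i.
have : 0 <= \sum_(j | j != i) normc ((Z *m Z^t*) i j) ^+ 2.
  by apply: sumr_ge0 => j _; exact: sqr_ge0.
set s := \sum_(j | _) _; have := weight_ge0 i; nra.
Qed.

(** In [weight_idem], a weight equal to its own square leaves nothing for the off-diagonal entries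
    of its row. *)
Lemma weight01 i : weight i = 0 \/ weight i = 1 ->
  forall j, j != i -> (Z *m Z^t*) i j = 0.
Proof.
move=> h j ji; have := weight_idem i.
have -> : weight i ^+ 2 = weight i by case: h => ->; rewrite ?expr0n ?expr1n.
move=> /(canRL (addKr _)); rewrite addrC subrr.
move=> /psumr_eq0P h0; apply: eq0_normc; apply/eqP.
by rewrite -sqrf_eq0 h0 // => ? _; exact: sqr_ge0.
Qed.

End Weights.

Lemma sum_ord_lt n k (F : nat -> R) : (k <= n)%N ->
  \sum_(i < k) F i = \sum_(i < n) F i * (i < k)%N%:R.
Proof.
move=> kn; rewrite (big_ord_widen _ F kn) [RHS](bigID (fun i : 'I_n => (i < k)%N)) /=.
rewrite [X in _ + X]big1 ?addr0 => [|i /negbTE ->]; last by rewrite mulr0.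
by apply: eq_bigr => i ->; rewrite mulr1.
Qed.

Lemma sum_lt_nat n k : (k <= n)%N -> \sum_(i < n) (i < k)%N%:R = k%:R :> R.
Proof.
move=> kn; have := sum_ord_lt (fun => 1) kn; rewrite sumr_const card_ord => ->.
by apply: eq_bigr => i _; rewrite mul1r.
Qed.

(** The value of the Ky Fan maximum. *)
Definition topsum n (A : 'M[R[i]]_n) k : R := \sum_(i < k) lambda A i.+1.

Section Spectral.
Variables (n : nat) (A V : 'M[R[i]]_n).
Hypothesis hA : hermitian A.
Hypothesis V2 : V *m V^t* = 1%:M.
Hypothesis AE : A = V *m evalmx A *m V^t*.
Variable k : nat.
Hypothesis k0 : (0 < k)%N.
Hypothesis kn : (k <= n)%N.
Implicit Types X Y : 'M[R[i]]_(n, k).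

Lemma stiefel_coord X : stiefel X -> stiefel (V^t* *m X).
Proof. by move=> hX; rewrite /stiefel adjmxM trmxCK mulmxA -[_ *m V *m _]mulmxA V2 mulmx1. Qed.

Lemma retr_rayleigh X :
  retr (rayleigh A X) = \sum_(i < n) lambda A i.+1 * weight (V^t* *m X) i.
Proof.
have -> : rayleigh A X = (V^t* *m X)^t* *m (evalmx A *m (V^t* *m X)).
  by rewrite /rayleigh {1}AE adjmxM trmxCK !mulmxA.
rewrite /retr mxtrace_mulC -mulmxA raddf_sum; apply: eq_bigr => i _ /=.
by rewrite mul_diag_mx mxE weightE mxE -rmorphM.
Qed.

(** The weights and the indicator of [i < k] both sum to [k], so the spectrum may be shifted by any
    [c]. The choice [lambda A k] serves to describe maximizers, the choice [lambda A k.+1] to bring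
    out the gap. *)
Lemma topsum_deficit X (c : R) : stiefel X ->
  topsum A k - retr (rayleigh A X) =
  \sum_(i < n) (lambda A i.+1 - c) * ((i < k)%N%:R - weight (V^t* *m X) i).
Proof.
move=> hX; rewrite retr_rayleigh /topsum (sum_ord_lt (fun i => lambda A i.+1) kn).
set w := weight _.
transitivity (\sum_(i < n) (lambda A i.+1 - c) * ((i < k)%N%:R - w i)
   + c * (\sum_(i < n) (i < k)%N%:R - \sum_i w i)).
  rewrite -sumrB -sumrB mulr_sumr -big_split /=.
  by apply: eq_bigr => i _; ring.
rewrite sum_weight; last exact: stiefel_coord.
by rewrite sum_lt_nat // subrr mulr0 addr0.
Qed.

(** Both factors change sign at [i = k], since weights lie between 0 and 1. The alternative
    [c = lambda A k] covers [k = n], where [lambda A k.+1] is the default value 0 and need not lie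
    below the spectrum. *)
Lemma deficit_term_ge0 X (c : R) (i : 'I_n) : stiefel X ->
  lambda A k.+1 <= c <= lambda A k \/ c = lambda A k ->
  0 <= (lambda A i.+1 - c) * ((i < k)%N%:R - weight (V^t* *m X) i).
Proof.
move=> hX hc; have hZ := stiefel_coord hX.
have w0 := weight_ge0 (V^t* *m X) i; have w1 := weight_le1 hZ i.
have k1 : (k.-1.+1 = k)%N by rewrite prednK.
case: (ltnP i k) => ik.
  rewrite mulr_ge0 ?subr_ge0 //.
  apply: (@le_trans _ _ (lambda A k)); last first.
    by rewrite -[in X in X <= _]k1 lambda_le // -ltnS k1.
  by case: hc => [/andP[]|->].
rewrite sub0r mulrN -mulNr opprB mulr_ge0 // subr_ge0.
case: hc => [/andP[h _]|->].
  by apply: le_trans h; rewrite lambda_le // .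
by rewrite -[in X in _ <= X]k1 lambda_le // (leq_trans _ ik) // leq_pred.
Qed.

Lemma retr_rayleigh_le X : stiefel X -> retr (rayleigh A X) <= topsum A k.
Proof.
move=> hX; rewrite -subr_ge0 (topsum_deficit (lambda A k) hX).
by apply: sumr_ge0 => i _; apply: deficit_term_ge0 => //; right.
Qed.

Definition maximizer X := stiefel X /\ retr (rayleigh A X) = topsum A k.

Lemma maximizer_weight X (i : 'I_n) : maximizer X ->
  lambda A i.+1 = lambda A k \/ weight (V^t* *m X) i = (i < k)%N%:R.
Proof.
move=> [hX eX]; have := topsum_deficit (lambda A k) hX.
rewrite eX subrr => /esym/psumr_eq0P => /(_ (fun i _ => deficit_term_ge0 i hX (or_intror erefl))).
move=> /(_ i isT) /eqP; rewrite mulf_eq0 !subr_eq0 => /orP[/eqP ->|/eqP ->]; first by left.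
by right.
Qed.

(** Beyond index [k] the eigenvalue differs from [lambda A k], so the weight is 0. The first [k]
    weights are then at most 1 with sum [k], which forces each to be 1 even if some of these
    eigenvalues equal [lambda A k]. *)
Lemma maximizer_weight_gap X (i : 'I_n) : maximizer X -> gap_pos A k ->
  weight (V^t* *m X) i = (i < k)%N%:R.
Proof.
move=> mX hg; have [hX _] := mX; have hZ := stiefel_coord hX.
have hi (j : 'I_n) : (k <= j)%N -> weight (V^t* *m X) j = 0.
  move=> kj; have kn' : (k < n)%N by apply: leq_ltn_trans kj (ltn_ord j).
  case: (maximizer_weight j mX) => [e|->]; last by rewrite ltnNge kj.
  have := hg kn'; rewrite /gap -e subr_gt0 => /lt_geF.
  by rewrite lambda_le.
case: ltnP => ik; last exact: hi.
have : \sum_(j < n) ((j < k)%N%:R - weight (V^t* *m X) j) = 0.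
  rewrite sumrB (sum_weight hZ).
  by rewrite sum_lt_nat // subrr.
move=> /psumr_eq0P /= h.
have /(_ i isT) : forall j : 'I_n, true -> (j < k)%N%:R - weight (V^t* *m X) j = 0.
  apply: h => j _; case: ltnP => jk; first by rewrite subr_ge0 weight_le1.
  by rewrite hi ?subrr.
by rewrite ik => /eqP; rewrite subr_eq0 => /eqP.
Qed.

(** All weights are 0 or 1, so [weight01] makes the projector diagonal in the eigenbasis. The
    right-hand side does not mention [X]: this is the uniqueness of the maximizing subspace. *)
Lemma maximizer_proj X : maximizer X -> gap_pos A k ->
  X *m X^t* = V *m diag_mx (\row_(i < n) (i < k)%N%:R) *m V^t*.
Proof.
move=> mX hg; have [hX _] := mX; have hZ := stiefel_coord hX.
have -> : diag_mx (\row_(i < n) (i < k)%N%:R) = (V^t* *m X) *m (V^t* *m X)^t*.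
  apply/matrixP => i j; have wi := maximizer_weight_gap i mX hg.
  have [->|ij] := eqVneq i j.
    rewrite weightE (maximizer_weight_gap _ mX hg) !mxE eqxx mulr1n.
    by rewrite rmorph_nat.
  rewrite !mxE (negbTE ij) mulr0n.
  have := weight01 hZ (i := i) _ (j := j); rewrite mxE => -> //.
    by rewrite wi; case: ltnP; [right|left].
  by rewrite eq_sym.
by rewrite adjmxM trmxCK !mulmxA V2 mul1mx -mulmxA V2 mulmx1.
Qed.

(** With [c = lambda A k.+1] the terms with [i >= k] are nonnegative, and each term with [i < k] is
    at least the gap times one minus the weight. *)
Lemma gap_deficit X Y : maximizer X -> stiefel Y -> (k < n)%N -> 0 < gap A k ->
  gap A k * (k%:R - nsq (X^t* *m Y)) <= topsum A k - retr (rayleigh A Y).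
Proof.
move=> mX hY kn' hg.
have hP := maximizer_proj mX (fun => hg).
have gk : lambda A k.+1 <= lambda A k by rewrite -subr_ge0 ltW.
(* [nsq (X^H Y)] is the trace of the product of the two projectors, and that of [X] is the diagonal
   0-1 matrix of [maximizer_proj]. *)
have -> : nsq (X^t* *m Y) = \sum_(i < n) weight (V^t* *m Y) i * (i < k)%N%:R.
  apply: complexI; rewrite nsqE mxtrace_mulC adjmxM trmxCK.
  rewrite mulmxA -[_ *m X *m _]mulmxA hP.
  have -> : Y^t* *m (V *m diag_mx (\row_(i < n) (i < k)%N%:R) *m V^t*) *m Y =
     (V^t* *m Y)^t* *m (diag_mx (\row_(i < n) (i < k)%N%:R) *m (V^t* *m Y)).
    by rewrite adjmxM trmxCK !mulmxA.
  rewrite mxtrace_mulC -mulmxA rmorph_sum; apply: eq_bigr => i _ /=.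
  by rewrite mul_diag_mx mxE weightE mxE rmorphM /= rmorph_nat mulrC.
have hc : lambda A k.+1 <= lambda A k.+1 <= lambda A k by rewrite lexx.
rewrite (topsum_deficit (lambda A k.+1) hY).
rewrite -(sum_lt_nat kn).
rewrite -sumrB mulr_sumr; apply: ler_sum => i _.
case: (ltnP i k) => ik; last first.
  have := deficit_term_ge0 i hY (or_introl hc); rewrite ltnNge ik /=.
  by rewrite mulr0 subrr mulr0.
rewrite mulr1; apply: ler_wpM2r; first by rewrite subr_ge0 weight_le1 //; exact: stiefel_coord.
rewrite /gap lerD2r -[in X in X <= _](prednK k0) lambda_le //.
  by rewrite -ltnS prednK.
exact: leq_ltn_trans (leq_pred _) kn'.
Qed.

End Spectral.
End KyFan.

(** Sylvester's determinant identity: the block matrix [M] is made triangular in two ways. Powers of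
    [t] are multiplied rather than divided, because [t] will be a polynomial. *)
Lemma det_sub_mulmxC (T : comNzRingType) n k (Z : 'M[T]_(n, k)) (W : 'M[T]_(k, n)) (t : T) :
  \det (t%:M - Z *m W) * t ^+ k = t ^+ n * \det (t%:M - W *m Z).
Proof.
pose M := block_mx t%:M Z W 1%:M.
have e1 : M *m block_mx 1%:M 0 (- W) 1%:M = block_mx (t%:M - Z *m W) Z 0 1%:M.
  by rewrite mulmx_block !mulmx1 !mulmx0 !add0r !mulmxN mul1mx subrr.
have e2 : M *m block_mx 1%:M (- Z) 0 t%:M = block_mx t%:M 0 W (t%:M - W *m Z).
  rewrite mulmx_block !mulmx1 !mulmx0 !addr0 !mulmxN mul1mx.
  by rewrite mul_mx_scalar mul_scalar_mx addNr [- _ + _]addrC.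
have := congr1 determinant e1; rewrite det_mulmx det_lblock det_ublock !det1 !mulr1 => <-.
have := congr1 determinant e2; rewrite det_mulmx det_lblock det_ublock !det1 !mul1r !det_scalar.
by [].
Qed.

Section Maximizers.
Variable R : realType.
Variables (n k : nat) (A : 'M[R[i]]_n).
Hypothesis hA : hermitian A.
Hypothesis k0 : (0 < k)%N.
Hypothesis kn : (k <= n)%N.
Implicit Types X Y : 'M[R[i]]_(n, k).

(** Let [D] be the diagonal form of [A] shifted by [c = lambda A k]. It vanishes on the only indices
    where the weights are undetermined, so the projector [Z Z^H] commutes with [D] and the product
    is the explicit diagonal [G]; this gives invariance of the range. For the eigenvalues, [G = Z W]
    while [W Z] is the shifted Rayleigh matrix, and [det_sub_mulmxC] relates their characteristic
    polynomials. *)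
Lemma maximizer_eigenspace X : maximizer A X -> top_eigenspace_eq A X.
Proof.
move=> mX; have [V [V1 V2 AE]] := hermitian_spectral hA.
have [hX _] := mX; have hZ := stiefel_coord V2 hX.
pose Z := V^t* *m X; pose c := lambda A k.
pose d (i : 'I_n) := lambda A i.+1 - c.
pose D := diag_mx (\row_i (d i)%:C).
pose G := diag_mx (\row_i (d i * (i < k)%N%:R)%:C).
have De : D = evalmx A - (c%:C)%:M.
  apply/matrixP => i j; rewrite !mxE rmorphB /=.
  by case: eqP => _; rewrite ?mulr1n ?mulr0n ?subr0.
have hw i := maximizer_weight hA V2 AE k0 kn i mX.
have w01 (i : 'I_n) : d i != 0 -> forall j, j != i -> (Z *m Z^t*) i j = 0.
  move=> di; apply: weight01 => //.
  case: (hw i) => [e|->]; first by move: di; rewrite /d e subrr eqxx.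
  by case: ltnP; [right|left].
have Pi i : (Z *m Z^t*) i i = (weight Z i)%:C by exact: weightE.
have Padj : (Z *m Z^t*)^t* = Z *m Z^t* by rewrite adjmxM trmxCK.
have w01' (i : 'I_n) : d i != 0 -> forall j, j != i -> (Z *m Z^t*) j i = 0.
  by move=> di j ji; rewrite -Padj adjmxE w01 // conjc0.
(* Column j of the product vanishes if [d j = 0]; otherwise the weight is 0 or 1 and only the
   diagonal entry survives. *)
have PD : (Z *m Z^t*) *m D = G.
  apply/matrixP => i j; rewrite mul_mx_diag mxE.
  move: (Z *m Z^t*) w01' Pi => P w01' Pi; rewrite [G _ _]mxE !mxE.
  have [<-|ij] := eqVneq i j.
    rewrite mulr1n Pi -rmorphM; congr (_%:C); rewrite mulrC.
    by case: (hw i) => [e|->]; rewrite // /d e subrr !mul0r.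
  rewrite mulr0n; have [->|dj] := eqVneq (d j) 0; first by rewrite rmorph0 mulr0.
  by rewrite (w01' j dj i ij) mul0r.
have Dadj : D^t* = D.
  apply/matrixP => i j; rewrite !mxE eq_sym; case: eqVneq => [->|_].
    by rewrite mulr1n; exact: conjc_real.
  by rewrite mulr0n rmorph0.
have Gadj : G^t* = G.
  apply/matrixP => i j; rewrite !mxE eq_sym; case: eqVneq => [->|_].
    by rewrite mulr1n; exact: conjc_real.
  by rewrite mulr0n rmorph0.
have DP : D *m (Z *m Z^t*) = G by rewrite -Gadj -PD (adjmxM _ D) Padj Dadj.
have rayE : rayleigh A X = Z^t* *m evalmx A *m Z.
  by rewrite /rayleigh {1}AE adjmxM trmxCK !mulmxA.
pose W := Z^t* *m D.
have WZ : W *m Z = rayleigh A X - (c%:C)%:M.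
  rewrite rayE /W De mulmxBr mulmxBl mul_mx_scalar -scalemxAl hZ.
  by rewrite scalemx1.
have ZW : Z *m W = G by rewrite /W mulmxA.
have rayH : hermitian (rayleigh A X) by exact: hermitian_conj.
split => //.
  have DZ : D *m Z = Z *m (rayleigh A X - (c%:C)%:M).
    by rewrite -WZ mulmxA ZW -DP -!mulmxA hZ mulmx1.
  have EZ : evalmx A *m Z = Z *m rayleigh A X.
    move: DZ; rewrite De mulmxBl mulmxBr mul_mx_scalar mul_scalar_mx.
    by move/(congr1 (fun M => M + c%:C *: Z)); rewrite !subrK.
  have XE : X = V *m Z by rewrite /Z mulmxA V2 mul1mx.
  rewrite {1}AE {2}XE -mulmxA -mulmxA -[V^t* *m X]/Z EZ.
  by rewrite -mulmxA.
pose s := take k (eigvals A).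
have size_s : size s = k by rewrite size_takel // size_eigvals.
have s_nth (i : 'I_k) : s`_i = lambda A i.+1 by rewrite /lambda nth_take.
apply: eigvals_eq; last first.
  by apply: take_sorted; exact: eigvals_sorted.
have sE : \prod_(x <- s) ('X - (x%:C)%:P) =
   \prod_(i < k) ('X - ((lambda A i.+1)%:C)%:P) :> {poly R[i]}.
  rewrite (big_nth 0) big_mkord size_s.
  by apply: eq_bigr => i _; rewrite s_nth.
(* Undoing the shift: with [t] as the variable, the [n - k] zero entries of [G] contribute
   [t ^+ (n - k)], and after multiplication by [t ^+ k] the factor [t ^+ n] cancels. *)
rewrite -/s sE; pose t : {poly R[i]} := 'X - (c%:C)%:P.
have t0 : t != 0 by rewrite /t polyXsubC_eq0.
have := det_sub_mulmxC (map_mx polyC Z) (map_mx polyC W) t.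
rewrite -!map_mxM ZW WZ.
have -> : t%:M - map_mx polyC (rayleigh A X - (c%:C)%:M) = char_poly_mx (rayleigh A X).
  rewrite map_mxB map_scalar_mx /= opprB addrA /t raddfB /= addrNK.
  by [].
rewrite -/(char_poly _).
have -> : t%:M - map_mx polyC G = diag_mx (\row_(i < n)
    ('X - (c%:C)%:P - (((d i * (i < k)%N%:R)%:C)%:P))).
  apply/matrixP => i j; rewrite !mxE /t.
  by case: eqP => _; rewrite ?mulr1n ?mulr0n ?polyC0 ?subr0.
rewrite det_diag.
have -> : \prod_(i < n) (\row_(i < n)
    ('X - (c%:C)%:P - (((d i * (i < k)%N%:R)%:C)%:P))) 0 i =
   \prod_(i < k) ('X - ((lambda A i.+1)%:C)%:P) * t ^+ (n - k).
  rewrite (bigID (fun i : 'I_n => (i < k)%N)) /=; congr (_ * _).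
    rewrite [RHS](big_ord_widen _ (fun i => 'X - ((lambda A i.+1)%:C)%:P) kn).
    apply: eq_bigr => i ik; rewrite mxE ik mulr1 /d rmorphB /= polyCB.
    by rewrite opprB addrA addrNK.
  rewrite (eq_bigr (fun _ => t)) => [|i /negbTE ik]; last first.
    by rewrite mxE ik mulr0 polyC0 subr0.
  rewrite prodr_const; congr (_ ^+ _); rewrite -[n in (n - k)%N]card_ord.
  rewrite -(cardC (fun i : 'I_n => (i < k)%N)) addnC.
  suff -> : #|(fun i : 'I_n => (i < k)%N)| = k by rewrite addnK.
  by rewrite -sum1_card -(big_ord_widen _ (fun => 1%N) kn) sum1_card card_ord.
rewrite -mulrA -exprD subnK // mulrC => /(mulfI _) -> //.
by rewrite expf_neq0.
Qed.

(** The projectors coincide, so [X^H Y] is unitary and carries one basis of the subspace to the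
    other. *)
Lemma maximizer_unique X Y : maximizer A X -> maximizer A Y -> gap_pos A k ->
  exists2 Q, stiefel Q & Y = X *m Q.
Proof.
move=> mX mY hg; have [V [V1 V2 AE]] := hermitian_spectral hA.
have eXY : X *m X^t* = Y *m Y^t*.
  by rewrite (maximizer_proj hA V2 AE k0 kn mX hg) (maximizer_proj hA V2 AE k0 kn mY hg).
have [_ hY] := mY; have {}hY : stiefel Y by case: mY.
exists (X^t* *m Y).
  rewrite /stiefel adjmxM trmxCK mulmxA -[_ *m X *m _]mulmxA eXY.
  by rewrite mulmxA hY mul1mx hY.
by rewrite mulmxA eXY -mulmxA hY mulmx1.
Qed.

Lemma top_eigenvectors_maximizer X : top_eigenvectors A X -> maximizer A X.
Proof.
case=> hX [s hs]; split=> //.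
rewrite /retr /rayleigh -mulmxA hs mulmxA hX mul1mx /topsum mxtrace_diag.
rewrite raddf_sum [RHS](reindex_inj (@perm_inj _ s)) /=.
by apply: eq_bigr => i _; rewrite mxE.
Qed.

Lemma retr_rayleigh_le_maximizer X Y : maximizer A X -> stiefel Y ->
  retr (rayleigh A Y) <= retr (rayleigh A X).
Proof.
move=> [_ ->] hY; have [V [V1 V2 AE]] := hermitian_spectral hA.
exact: (retr_rayleigh_le hA V2 AE).
Qed.

Lemma maximizer_of_ge X Y : maximizer A X -> stiefel Y ->
  retr (rayleigh A X) <= retr (rayleigh A Y) -> maximizer A Y.
Proof.
move=> mX hY le; split=> //; apply/eqP; rewrite eq_le.
rewrite -mX.2 le andbT.
exact: retr_rayleigh_le_maximizer.
Qed.

Lemma gap_ge0 : (k < n)%N -> 0 <= gap A k.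
Proof. by move=> kn'; rewrite subr_ge0 -[in leRHS](prednK k0) lambda_le // leq_pred. Qed.

Lemma gap_mul_nsq_le X Y : maximizer A X -> stiefel Y -> (k < n)%N ->
  gap A k * (k%:R - nsq (X^t* *m Y)) <=
    retr (rayleigh A X) - retr (rayleigh A Y).
Proof.
move=> mX hY kn'; have [V [V1 V2 AE]] := hermitian_spectral hA.
(* [gap_deficit] requires a positive gap; for a zero gap the left side vanishes and the claim is Ky
   Fan's inequality. *)
have := gap_ge0 kn'; rewrite le_eqVlt => /orP[/eqP <-|g0].
  by rewrite mul0r subr_ge0 retr_rayleigh_le_maximizer.
by rewrite mX.2; exact: (gap_deficit hA V2 AE).
Qed.

End Maximizers.

(** * Canonical angles and residuals *)

Section Angles.
Variable R : realType.

(** In an eigenbasis of the Gram matrix the eigenvalues are the squared lengths of the columns of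
    [C V]. Their sign, their upper bound and their sum are read off from this form. *)
Lemma lambda_gram p k (C : 'M[R[i]]_(p, k)) :
  exists V : 'M[R[i]]_k, [/\ V^t* *m V = 1%:M, V *m V^t* = 1%:M &
    forall i : 'I_k, lambda (C^t* *m C) i.+1 = \sum_j normc ((C *m V) j i) ^+ 2].
Proof.
have hM : hermitian (C^t* *m C) by rewrite /hermitian adjmxM trmxCK.
have [V [V1 V2 ME]] := hermitian_spectral hM.
exists V; split=> // i; apply: complexI.
have : (C *m V)^t* *m (C *m V) = evalmx (C^t* *m C).
  rewrite adjmxM -mulmxA [C^t* *m _]mulmxA {1}ME -!mulmxA V1 mulmx1.
  by rewrite mulmxA V1 mul1mx.
move=> /matrixP/(_ i i); rewrite [in RHS]mxE [in RHS]mxE eqxx mulr1n => <-.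
rewrite mxE rmorph_sum; apply: eq_bigr => j _.
by rewrite adjmxE mulrC; exact/esym/normc_sqr.
Qed.

(** Each squared sine is one minus a squared singular value. The arccosine is genuine because [X^H]
    contracts the unit columns of [Y V], so singular values are at most 1; their squares sum to
    [nsq (X^H Y V) = nsq (X^H Y)]. *)
Lemma sin_theta_sqr n k (X Y : 'M[R[i]]_(n, k)) : stiefel X -> stiefel Y ->
  sin_theta X Y ^+ 2 = k%:R - nsq (X^t* *m Y).
Proof.
move=> hX hY; have [V [V1 V2 lamE]] := lambda_gram (X^t* *m Y).
rewrite /sin_theta sqr_sqrtr; last first.
  by apply: sumr_ge0 => i _; exact: sqr_ge0.
rewrite big_add1 big_mkord /=.
have lam0 (i : 'I_k) : 0 <= lambda ((X^t* *m Y)^t* *m (X^t* *m Y)) i.+1.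
  by rewrite lamE sumr_ge0 // => j _; exact: sqr_ge0.
have hYV : stiefel (Y *m V).
  by rewrite /stiefel adjmxM mulmxA -[_ *m Y^t* *m Y]mulmxA hY mulmx1.
have lam1 (i : 'I_k) : lambda ((X^t* *m Y)^t* *m (X^t* *m Y)) i.+1 <= 1.
  have := nsq_adj_stiefel_le (col i (Y *m V)) hX.
  have -> : nsq (col i (Y *m V)) = 1.
    apply: complexI; rewrite nsqE mxtrace_mulC /mxtrace big_ord1 rmorph1.
    have /matrixP/(_ i i) := hYV; rewrite !mxE eqxx mulr1n => <-.
    by apply: eq_bigr => j _; rewrite !mxE.
  have -> : X^t* *m col i (Y *m V) = col i (X^t* *m (Y *m V)) by rewrite !colE mulmxA.
  apply: le_trans; rewrite lamE -mulmxA le_eqVlt; apply/orP; left; apply/eqP.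
  by apply: eq_bigr => j _; rewrite big_ord1 [in RHS]mxE.
have sin2 (i : 'I_k) : sin (canonical_angle X Y i.+1) ^+ 2 =
   1 - lambda ((X^t* *m Y)^t* *m (X^t* *m Y)) i.+1.
  rewrite /canonical_angle /sigma; set l := lambda _ _.
  have l0 : 0 <= l := lam0 i; have l1 : l <= 1 := lam1 i.
  rewrite sin2cos2 acosK ?sqr_sqrtr // in_itv /=.
  rewrite (le_trans _ (sqrtr_ge0 l)) ?oppr_le0 ?ler01 //=.
  by rewrite -[leRHS]sqrtr1 ler_sqrt.
under eq_bigr do rewrite sin2 lamE.
rewrite sumrB sumr_const card_ord; congr (_ - _).
rewrite exchange_big /= -/(nsq (X^t* *m Y *m V)).
rewrite -[RHS]nsq_adj -[RHS](nsqMl_stiefel (X := V^t*)); last by rewrite /stiefel trmxCK.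
by rewrite -adjmxM nsq_adj.
Qed.

(** The residual is [(1 - Y Y^H) A Y]. Since [A] commutes with [X X^H], [A Y] splits into a part in
    the range of [X] and [A E], where [E] is the part of [Y] orthogonal to that range. Each
    contributes at most [nsq A] times the squared sine; the constant 4 is these two terms times the
    factor 2 of [nsqD_le]. *)
Lemma nsq_residual_le n k (A : 'M[R[i]]_n) (X Y : 'M[R[i]]_(n, k)) :
  hermitian A -> stiefel X -> stiefel Y -> A *m X = X *m rayleigh A X ->
  nsq (A *m Y - Y *m rayleigh A Y) <=
    4 * nsq A * (k%:R - nsq (X^t* *m Y)).
Proof.
move=> hA hX hY AX.
have hL : (rayleigh A X)^t* = rayleigh A X by exact: hermitian_conj.
have XA : X^t* *m A = rayleigh A X *m X^t*.
  by rewrite -[in LHS]hA -adjmxM AX adjmxM hL.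
pose E := Y - X *m (X^t* *m Y).
have AY : A *m Y = X *m (X^t* *m (A *m Y)) + A *m E.
  rewrite mulmxBr addrCA !mulmxA AX -[X *m X^t* *m A]mulmxA XA !mulmxA.
  by rewrite subrr addr0.
pose cp r (M : 'M[R[i]]_(n, r)) := M - Y *m (Y^t* *m M).
have -> : A *m Y - Y *m rayleigh A Y =
   cp _ X *m (X^t* *m (A *m Y)) + cp _ (A *m E).
  rewrite /rayleigh -mulmxA {1 2}AY /cp mulmxBl !mulmxDr opprD !mulmxA.
  by rewrite addrACA.
apply: le_trans (nsqD_le _ _) _.
have AY_le : nsq (X^t* *m (A *m Y)) <= nsq A.
  apply: le_trans (nsq_adj_stiefel_le _ hX) _.
  by rewrite -nsq_adj adjmxM hA; exact: nsq_adj_stiefel_le.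
have nE : nsq E = k%:R - nsq (X^t* *m Y).
  by rewrite nsq_coproj // (nsq_stiefel hY).
have ncp : nsq (cp _ X) = k%:R - nsq (X^t* *m Y).
  by rewrite nsq_coproj // (nsq_stiefel hX) -nsq_adj adjmxM trmxCK.
have h1 : nsq (cp _ X *m (X^t* *m (A *m Y))) <= nsq (cp _ X) * nsq A.
  apply: le_trans (nsqM_le _ _) _.
  by rewrite ler_wpM2l // nsq_ge0.
have h2 : nsq (cp _ (A *m E)) <= nsq A * nsq E.
  rewrite nsq_coproj //; apply: le_trans (nsqM_le _ _).
  by rewrite gerBl nsq_ge0.
by rewrite ncp in h1; rewrite nE in h2; lra.
Qed.

End Angles.

(** * Entries of the tensor contractions *)

Section TensorEntries.
Variables (R : realType).

(** Distributivity for dependent multi-indices: [big_fprod] turns them into families of tagged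
    values, to which [bigA_distr_big_dep] applies. *)
Lemma sum_midx_prod m (d : 'I_m -> nat) (F : forall r, 'I_(d r) -> R[i]) :
  \sum_(i : midx d) \prod_r F r (i r) = \prod_r \sum_(a : 'I_(d r)) F r a.
Proof.
pose P_ (r : 'I_m) : {ffun 'I_(d r) -> R[i]} := [ffun a => F r a].
transitivity (\sum_(t : fprod (fun r => 'I_(d r) : finType)) \prod_(r in 'I_m) P_ r (t r)).
  rewrite (reindex (@dffun_of_fprod 'I_m (fun r => 'I_(d r) : finType))) /=; last first.
    exact/onW_bij/dffun_of_fprod_bij.
  by apply: eq_bigr => t _; apply: eq_bigr => r _; rewrite !ffunE.
rewrite big_fprod.
have -> : \prod_r \sum_(a : 'I_(d r)) F r a =
   \prod_r \sum_(j in tagged_with (fun r => 'I_(d r) : finType) r) untag 0 (P_ r) j.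
  apply: eq_bigr => r _; transitivity (\sum_(a : 'I_(d r)) P_ r a).
    by apply: eq_bigr => a _; rewrite ffunE.
  exact: (@big_tag _ 0 +%R 'I_m (fun r => 'I_(d r) : finType) P_ r).
by rewrite bigA_distr_big_dep.
Qed.

(* Entries addressed by natural numbers, so that matrices whose sizes are only
   propositionally equal can be compared. *)
Definition nent p q (M : 'M[R[i]]_(p, q)) (a b : nat) : R[i] :=
  if (insub a : option 'I_p) is Some a' then
    if (insub b : option 'I_q) is Some b' then M a' b' else 0
  else 0.

Lemma nentE p q (M : 'M[R[i]]_(p, q)) (a : 'I_p) (b : 'I_q) : nent M a b = M a b.
Proof. by rewrite /nent !valK. Qed.

Lemma nent_conform p q p' q' (M0 : 'M[R[i]]_(p, q)) (M : 'M[R[i]]_(p', q')) a b :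
  p' = p -> q' = q -> nent (conform_mx M0 M) a b = nent M a b.
Proof. by move=> ep eq; subst p' q'; rewrite conform_mx_id. Qed.

Lemma nent_adj p q (M : 'M[R[i]]_(p, q)) a b : nent (M^t*) a b = (nent M b a)^*.
Proof.
rewrite /nent; case: insubP => [a' _ _|_]; case: insubP => [b' _ _|_];
  by rewrite ?adjmxE ?conjc0.
Qed.

Variables (m : nat) (n k : 'I_m -> nat).
Variable P : forall l, 'M[R[i]]_(n l, k l).

Lemma foldl_set_dim s (d : 'I_m -> nat) r :
  foldl (set_dim k) d s r = if r \in s then k r else d r.
Proof.
elim: s d => [//|l s IH] d /=; rewrite IH /set_dim inE.
by case: (r \in s); rewrite ?orbT ?orbF.
Qed.

(** The hypothesis that [d] and [n] agree on [s] is what makes each [conform_mx] a transport instead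
    of its default 0. It survives the induction because [s] has no repetition. *)
Lemma multi_mulE s (d : 'I_m -> nat) (T : tensor R d) i :
  uniq s -> {in s, forall l, d l = n l} ->
  multi_mul P s T i =
    \sum_(j : midx d | [forall r, (r \notin s) ==> (i r == j r :> nat)])
      (\prod_(r <- s) (nent (P r) (j r) (i r))^*) * T j.
Proof.
elim: s d T i => [|l s IH] d T i.
  move=> _ _ /=; rewrite (big_pred1 i) => [|j]; first by rewrite big_nil mul1r.
  apply/forallP/eqP => [h|-> r] //=.
  apply/ffunP => r; apply/val_inj/esym/eqP; exact: h.
move=> /= /andP[ls us] hd; rewrite IH //; last first.
  move=> r rs; rewrite /set_dim; case: eqP => [e|_]; first by rewrite -e rs in ls.
  by apply: hd; rewrite inE rs orbT.
under eq_bigr do rewrite ffunE mulr_sumr.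
rewrite (exchange_big_dep (fun j : midx d =>
   [forall r, (r \notin l :: s) ==> (i r == j r :> nat)])) /=; last first.
  move=> j' j /forallP h1 /forallP h2; apply/forallP => r; apply/implyP.
  rewrite inE negb_or => /andP[rl rs].
  have /implyP/(_ rs)/eqP -> := h1 r.
  by have /implyP/(_ rl) := h2 r.
apply: eq_bigr => j /forallP hj.
have il : (i l < k l)%N.
  by have := ltn_ord (i l); rewrite [X in (_ < X)%N]foldl_set_dim mem_head.
(* The only intermediate multi-index compatible with both [i] and [j]: mode [l] has been contracted
   and carries the subscript of [i], every other mode still carries that of [j]. *)
have [J hJ] : exists J : midx (set_dim k d l),
    forall r, J r = (if r == l then i l : nat else j r) :> nat.
  have [f hf] : exists f : forall r, 'I_(set_dim k d l r),
      forall r, f r = (if r == l then i l : nat else j r) :> nat.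
    apply: (@fin_all_exists _ (fun r => 'I_(set_dim k d l r))
      (fun r a => a = (if r == l then i l : nat else j r) :> nat)) => r.
    have lt : ((if r == l then i l : nat else j r) < set_dim k d l r)%N.
      by rewrite /set_dim; case: eqP => [->//|_]; exact: ltn_ord.
    by exists (Ordinal lt).
  by exists [ffun r => f r] => r; rewrite ffunE.
rewrite (big_pred1 J) => [|j']; last first.
  apply/andP/eqP => [[/forallP h1 /forallP h2]|->].
    apply/ffunP => r; apply/val_inj; rewrite /= hJ; case: eqP => [->|/eqP rl].
      by have /implyP/(_ ls)/eqP := h1 l.
    by have /implyP/(_ rl)/eqP := h2 r.
  split; apply/forallP => r; apply/implyP => h; rewrite hJ.
    case: (eqVneq r l) => [->//|rl].
    by have := hj r; rewrite inE negb_or h rl.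
  by rewrite (negbTE h).
rewrite mulrA big_cons; congr (_ * _); rewrite mulrC; congr (_ * _).
  rewrite -[LHS]nentE nent_adj nent_conform ?hJ ?eqxx //.
    by rewrite hd // inE eqxx.
  by rewrite /set_dim eqxx.
rewrite !big_seq; apply: eq_bigr => r rs; rewrite hJ.
by case: eqP => // e; rewrite -e rs in ls.
Qed.

End TensorEntries.

(** * The objective and the matrices [H_l] as polynomials in the [P_r P_r^H] *)

Section Gram.
Variables (R : realType) (m : nat) (n k : 'I_m -> nat).
Implicit Types P : forall l, 'M[R[i]]_(n l, k l).

Lemma gram_nent p q q' (M : 'M[R[i]]_(p, q)) (x y : 'I_p) : q' = q ->
  \sum_(a < q') (nent M x a)^* * nent M y a = (M *m M^t*) y x.
Proof.
move=> ->; rewrite mxE; apply: eq_bigr => a _.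
by rewrite !nentE adjmxE mulrC.
Qed.

Lemma normc_sqr_sum (I : finType) (D : pred I) (F : I -> R[i]) :
  (normc (\sum_(j | D j) F j) ^+ 2)%:C =
  \sum_(j | D j) \sum_(j' | D j') F j * (F j')^*.
Proof.
rewrite normc_sqr (rmorph_sum (@conjc R)) mulr_suml.
by apply: eq_bigr => j _; rewrite mulr_sumr.
Qed.

(** After expanding the squared moduli, the sum over output subscripts factors over the modes, and
    the factor of mode r is an entry of [P_r P_r^H]. *)
Lemma objectiveE (B : tensor R n) P :
  (objective B P)%:C = \sum_j \sum_j' B j * (B j')^* *
     \prod_r (P r *m (P r)^t*) (j' r) (j r).
Proof.
rewrite /objective /fro_tensor sqr_sqrtr; last first.
  by apply: sumr_ge0 => i _; exact: sqr_ge0.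
rewrite rmorph_sum /=.
transitivity (\sum_(i : midx (foldl (set_dim k) n (enum 'I_m)))
   \sum_j \sum_j' B j * (B j')^* *
   \prod_r ((nent (P r) (j r) (i r))^* * nent (P r) (j' r) (i r))).
  apply: eq_bigr => i _; rewrite multi_mulE ?enum_uniq //.
  rewrite normc_sqr_sum; apply: eq_big => [j|j _].
    by apply/forallP => r; rewrite mem_enum.
  apply: eq_big => [j'|j' _].
    by apply/forallP => r; rewrite mem_enum.
  rewrite !big_enum /= rmorphM rmorph_prod big_split /=.
  under [X in _ * (X * _)]eq_bigr do rewrite conjCK.
  by rewrite mulrACA mulrC.
rewrite exchange_big; apply: eq_bigr => j _ /=.
rewrite exchange_big; apply: eq_bigr => j' _ /=.
rewrite -mulr_sumr; congr (_ * _).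
rewrite (sum_midx_prod (fun r a => (nent (P r) (j r) a)^* * nent (P r) (j' r) a)).
apply: eq_bigr => r _; apply: gram_nent.
by rewrite foldl_set_dim mem_enum.
Qed.

Lemma val_ecast (I : Type) (d : I -> nat) (r r' : I) (e : r = r') (a : 'I_(d r)) :
  ecast x 'I_(d x) e a = a :> nat.
Proof. by case: r' / e. Qed.

Lemma fiber_idx_mode d (l : 'I_m) (a : 'I_(d l)) (c : fiber d l) :
  fiber_idx a c l = a :> nat.
Proof.
rewrite ffunE; case: unliftP => [t e|e]; rewrite val_ecast //.
by case/eqP: (neq_lift l t).
Qed.

Lemma fiber_idx_lift d (l : 'I_m) (a : 'I_(d l)) (c : fiber d l) t :
  fiber_idx a c (lift l t) = c t :> nat.
Proof.
rewrite ffunE; case: unliftP => [t' e|e]; rewrite val_ecast.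
  by rewrite (lift_inj e).
by case/eqP: (neq_lift l t).
Qed.

Lemma big_neq_lift (l : 'I_m) (F : 'I_m -> R[i]) :
  \prod_(r | r != l) F r = \prod_(t : 'I_m.-1) F (lift l t).
Proof.
rewrite (reindex_omap (lift l) (unlift l)) => [|r rl].
  by apply: eq_bigl => t; rewrite liftK eqxx eq_sym neq_lift.
by rewrite eq_sym in rl; have [t -> ->] := unlift_some rl.
Qed.

Lemma CmatE (B : tensor R n) (l : 'I_m) P (a : 'I_(n l)) c :
  Cmat B l P a c = \sum_(j : midx n | j l == a)
    (\prod_(t : 'I_m.-1) (nent (P (lift l t)) (j (lift l t)) (enum_val c t))^*) * B j.
Proof.
set d := foldl (set_dim k) n (other_modes l) in c *.
have lo : l \notin other_modes l by rewrite mem_filter eqxx.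
have dl : d l = n l by rewrite /d foldl_set_dim (negbTE lo).
have uo : uniq (other_modes l) by rewrite filter_uniq ?enum_uniq.
rewrite -[LHS]nentE /Cmat nent_conform //.
rewrite -[a : nat]/(cast_ord (esym dl) a : nat) nentE mxE multi_mulE //.
apply: eq_big => [j|j _].
  apply/forallP/eqP => [/(_ l)/implyP/(_ lo)|jl r].
    by rewrite fiber_idx_mode /= => /eqP e; apply/val_inj.
  apply/implyP; rewrite mem_filter mem_enum andbT negbK => /eqP ->.
  by rewrite fiber_idx_mode jl.
congr (_ * _); rewrite /other_modes big_filter big_enum_cond /=.
by rewrite big_neq_lift; apply: eq_bigr => t _; rewrite fiber_idx_lift.
Qed.

Lemma HmatE (B : tensor R n) (l : 'I_m) P a b :
  Hmat B l P a b = \sum_(j : midx n | j l == a) \sum_(j' : midx n | j' l == b)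
    B j * (B j')^* * \prod_(r | r != l) (P r *m (P r)^t*) (j' r) (j r).
Proof.
set d := foldl (set_dim k) n (other_modes l).
have od t : d (lift l t) = k (lift l t).
  by rewrite /d foldl_set_dim mem_filter mem_enum eq_sym neq_lift.
rewrite mxE.
transitivity (\sum_(c : fiber d l) \sum_(j : midx n | j l == a)
  \sum_(j' : midx n | j' l == b) B j * (B j')^* *
   \prod_(t : 'I_m.-1) ((nent (P (lift l t)) (j (lift l t)) (c t))^*
     * nent (P (lift l t)) (j' (lift l t)) (c t))).
  rewrite [RHS](reindex (@enum_val (fiber d l) (fiber d l))) /=; last first.
    exact/onW_bij/enum_val_bij.
  apply: eq_bigr => c _; rewrite adjmxE !CmatE (rmorph_sum (@conjc R)) mulr_suml.
  apply: eq_bigr => j _; rewrite mulr_sumr; apply: eq_bigr => j' _.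
  rewrite rmorphM rmorph_prod big_split /=.
  rewrite [X in _ * (X * _)](eq_bigr (fun t => nent (P (lift l t)) (j' (lift l t))
    (enum_val c t))) => [|t _]; last exact: conjCK.
  by rewrite mulrACA mulrC.
rewrite exchange_big; apply: eq_bigr => j _ /=.
rewrite exchange_big; apply: eq_bigr => j' _ /=.
rewrite -mulr_sumr; congr (_ * _).
rewrite (sum_midx_prod (fun t a => (nent (P (lift l t)) (j (lift l t)) a)^* *
  nent (P (lift l t)) (j' (lift l t)) a)).
rewrite big_neq_lift; apply: eq_bigr => t _; apply: gram_nent.
exact: od.
Qed.

Lemma hermitian_Hmat (B : tensor R n) l P : hermitian (Hmat B l P).
Proof. by rewrite /hermitian /Hmat adjmxM trmxCK. Qed.

(** Grouping [j] and [j'] in [objectiveE] by their l-th subscripts and splitting off the factor of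
    mode [l] leaves exactly the entries given by [HmatE]. *)
Lemma objective_rayleigh (B : tensor R n) l P :
  objective B P = retr (rayleigh (Hmat B l P) (P l)).
Proof.
rewrite /retr /rayleigh -mulmxA mxtrace_mulC -mulmxA.
suff <- : (objective B P)%:C = \tr (Hmat B l P *m (P l *m (P l)^t*)) by [].
rewrite objectiveE /mxtrace.
transitivity (\sum_(a < n l) \sum_(b < n l)
   \sum_(j : midx n | j l == a) \sum_(j' : midx n | j' l == b)
    B j * (B j')^* * \prod_r (P r *m (P r)^t*) (j' r) (j r)).
  rewrite (partition_big (fun j : midx n => j l) xpredT) //=.
  apply: eq_bigr => a _; rewrite [RHS]exchange_big /=; apply: eq_bigr => j _.
  by rewrite (partition_big (fun j : midx n => j l) xpredT).
apply: eq_bigr => a _; rewrite mxE; apply: eq_bigr => b _.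
rewrite HmatE mulr_suml; apply: eq_bigr => j /eqP ja.
rewrite mulr_suml; apply: eq_bigr => j' /eqP jb.
by rewrite (bigD1 l) //= ja jb -!mulrA; congr (_ * (_ * _)); rewrite mulrC.
Qed.

(** Every invariance used later comes from here: right unitary factors on the other modes do not
    change [H_l]. *)
Lemma Hmat_gram (B : tensor R n) l P P' :
  (forall r, r != l -> P r *m (P r)^t* = P' r *m (P' r)^t*) ->
  Hmat B l P = Hmat B l P'.
Proof.
move=> h; apply/matrixP => a b; rewrite !HmatE.
apply: eq_bigr => j _; apply: eq_bigr => j' _; congr (_ * _).
by apply: eq_bigr => r rl; rewrite h.
Qed.

End Gram.

(** * Sequences of complex matrices *)

Section Subsequences.

Lemma leq_subseq (phi : nat -> nat) : {homo phi : i j / (i < j)%N} ->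
  forall i, (i <= phi i)%N.
Proof. by move=> h; elim=> // i IH; apply: leq_ltn_trans IH (h _ _ _). Qed.

Lemma cvg_subseq_infty (phi : nat -> nat) : {homo phi : i j / (i < j)%N} ->
  phi @ \oo --> \oo.
Proof.
move=> h A [N _ hN]; exists N => // i /= Ni; apply: hN => /=.
exact: leq_trans Ni (leq_subseq h i).
Qed.

Lemma homo_ltn_comp (f g : nat -> nat) : {homo f : i j / (i < j)%N} ->
  {homo g : i j / (i < j)%N} -> {homo (f \o g) : i j / (i < j)%N}.
Proof. by move=> hf hg i j ij; apply/hf/hg. Qed.

Lemma cvg_subseq (T : topologicalType) (u : nat -> T) (x : T) (phi : nat -> nat) :
  {homo phi : i j / (i < j)%N} -> u @ \oo --> x -> (fun i => u (phi i)) @ \oo --> x.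
Proof. by move=> hphi ux A hA; exact: (cvg_subseq_infty hphi (ux A hA)). Qed.

(** Bolzano-Weierstrass applied to one member after another; earlier limits survive further
    extraction. *)
Lemma bounded_family_subseq (R : realType) (T : finType) (u : T -> nat -> R) (M : R) :
  (forall t i, `|u t i| <= M) ->
  exists2 phi : nat -> nat, {homo phi : i j / (i < j)%N} &
    forall t, cvgn (fun i => u t (phi i)).
Proof.
move=> hu; suff [phi hphi cphi] : exists2 phi : nat -> nat,
    {homo phi : i j / (i < j)%N} & {in enum T, forall t, cvgn (fun i => u t (phi i))}.
  by exists phi => // t; apply: cphi; rewrite mem_enum.
elim: (enum T) => [|t s [phi hphi cphi]]; first by exists id.
have [|psi hpsi cpsi] := @bolzano_weierstrass R (fun i => u t (phi i)).
  exists M; split; first exact: num_real.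
  by move=> x Mx i _ /=; apply: le_trans (hu _ _) (ltW Mx).
have hpsi' : {homo psi : i j / (i < j)%N}.
  by move=> i j; rewrite ltnNge (ltnNge (psi i)) -(hpsi j i).
exists (phi \o psi); first exact: homo_ltn_comp.
move=> t'; rewrite inE => /orP[/eqP ->//|t's] /=.
have /cvg_ex[l hl] := cphi _ t's.
by apply/cvg_ex; exists l; apply: (cvg_subseq hpsi' hl).
Qed.

End Subsequences.

Section Convergence.

Lemma cvg_prod_topology (I : eqType) (T : I -> topologicalType)
    (u : nat -> prod_topology T) (x : prod_topology T) :
  u @ \oo --> x <-> forall i, (fun j => u j i) @ \oo --> x i.
Proof.
split=> [ux i|h].
  by move=> A hA; exact: (ux _ (@proj_continuous I T i x A hA)).
apply/cvg_sup => i A [B [[W oW <-]]] /= Wx BA.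
apply: filterS BA _.
apply: (h i); exact: open_nbhs_nbhs.
Qed.

Lemma cvg_matrix (T : topologicalType) p q (u : nat -> 'M[T]_(p, q)) (x : 'M[T]_(p, q)) :
  u @ \oo --> x <-> forall a b, (fun j => u j a b) @ \oo --> x a b.
Proof.
split=> [ux a b Q hQ|h A [Q hQ QA]].
  apply: (ux [set N : 'M[T]_(p, q) | Q (N a b)]).
  exists (fun a' b' => [set y | a' = a -> b' = b -> Q y]) => [a' b'|N /=].
    have [->|na] := eqVneq a' a; last by near=> y => /eqP; rewrite (negbTE na).
    have [->|nb] := eqVneq b' b; last by near=> y => _ /eqP; rewrite (negbTE nb).
    by near=> y => _ _; near: y.
  by move/(_ a b); apply.
have : \forall j \near \oo, forall a b, Q a b (u j a b).
  by apply: filter_forall => a; apply: filter_forall => b; apply: h; exact: hQ.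
by apply: filterS => j; exact: QA.
Unshelve. all: by end_near. Qed.

Variable R : realType.

Lemma normc_norm (z : R[i]) : `|z| = (normc z)%:C.
Proof. by rewrite normc_def; case: z. Qed.

(** Reduces the algebra of complex limits to that of real ones. *)
Definition cvgC (u : nat -> R[i]) (x : R[i]) :=
  (fun i => Re (u i)) @ \oo --> Re x /\ (fun i => Im (u i)) @ \oo --> Im x.

Lemma normc_ge_Re (z : R[i]) : `|Re z| <= normc z.
Proof. by rewrite -sqrtr_sqr; case: z => a b /=; rewrite ler_wsqrtr // lerDl sqr_ge0. Qed.

Lemma normc_ge_Im (z : R[i]) : `|Im z| <= normc z.
Proof. by rewrite -sqrtr_sqr; case: z => a b /=; rewrite ler_wsqrtr // lerDr sqr_ge0. Qed.

Lemma normc_le_ReIm (z : R[i]) : normc z <= `|Re z| + `|Im z|.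
Proof.
rewrite -[leRHS]ger0_norm ?addr_ge0 // -sqrtr_sqr; case: z => a b /=.
rewrite ler_wsqrtr // sqrrD !real_normK ?num_real // lerD2r lerDl.
by rewrite mulrn_wge0 // mulr_ge0.
Qed.

Lemma cvg_complex (u : nat -> R[i]) (x : R[i]) : u @ \oo --> x <-> cvgC u x.
Proof.
split=> [/cvgrPdist_lt h|[/cvgrPdist_lt hr /cvgrPdist_lt hi]].
  split; apply/cvgrPdist_lt => e e0.
    have /h : 0 < e%:C by rewrite ltcR.
    apply: filterS => i; rewrite normc_norm ltcR; apply: le_lt_trans.
    by rewrite -raddfB normc_ge_Re.
  have /h : 0 < e%:C by rewrite ltcR.
  apply: filterS => i; rewrite normc_norm ltcR; apply: le_lt_trans.
  by rewrite -raddfB normc_ge_Im.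
apply/cvgrPdist_lt => e e0.
have eE : e = (Re e)%:C by rewrite RRe_real // gtr0_real.
have e0' : 0 < Re e / 2 by rewrite divr_gt0 // -ltcR -eE.
near=> i; rewrite normc_norm eE ltcR.
apply: le_lt_trans (normc_le_ReIm _) _; rewrite !raddfB /=.
rewrite [ltRHS]splitr ltrD //; near: i; [exact: hr|exact: hi].
Unshelve. all: by end_near. Qed.

Lemma cvgC_cst x : cvgC (fun=> x) x.
Proof. by split; exact: cvg_cst. Qed.

Lemma cvgCD u v x y : cvgC u x -> cvgC v y -> cvgC (fun i => u i + v i) (x + y).
Proof.
move=> [ur ui] [vr vi]; split.
  by rewrite raddfD /=; under eq_cvg do rewrite raddfD; exact: cvgD.
by rewrite raddfD /=; under eq_cvg do rewrite raddfD; exact: cvgD.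
Qed.

Lemma cvgCM u v x y : cvgC u x -> cvgC v y -> cvgC (fun i => u i * v i) (x * y).
Proof.
have reM (a b : R[i]) : Re (a * b) = Re a * Re b - Im a * Im b by case: a; case: b.
have imM (a b : R[i]) : Im (a * b) = Re a * Im b + Im a * Re b.
  by case: a => a a'; case: b => b b'.
move=> [ur ui] [vr vi]; split.
  by rewrite reM; under eq_cvg do rewrite reM; apply: cvgB; exact: cvgM.
by rewrite imM; under eq_cvg do rewrite imM; apply: cvgD; exact: cvgM.
Qed.

Lemma cvgC_conj u x : cvgC u x -> cvgC (fun i => (u i)^*) x^*.
Proof.
have reE (a : R[i]) : Re a^* = Re a by case: a.
have imE (a : R[i]) : Im a^* = - Im a by case: a.
move=> [ur ui]; split; first by rewrite reE; under eq_cvg do rewrite reE.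
by rewrite imE; under eq_cvg do rewrite imE; exact: cvgN.
Qed.

Lemma cvgC_sum (I : Type) (r : seq I) (D : pred I) (u : nat -> I -> R[i]) x :
  (forall a, cvgC (u ^~ a) (x a)) ->
  cvgC (fun i => \sum_(a <- r | D a) u i a) (\sum_(a <- r | D a) x a).
Proof.
move=> h; elim: r => [|a r IH].
  rewrite big_nil; have := cvgC_cst 0; congr cvgC.
  by apply/funext => i; rewrite big_nil.
rewrite big_cons.
have -> : (fun i => \sum_(a <- a :: r | D a) u i a) =
   (fun i => if D a then u i a + \sum_(a <- r | D a) u i a else \sum_(a <- r | D a) u i a).
  by apply/funext => i; rewrite big_cons.
by case: (D a) => //; exact: cvgCD.
Qed.

Lemma cvgC_prod (I : Type) (r : seq I) (D : pred I) (u : nat -> I -> R[i]) x :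
  (forall a, cvgC (u ^~ a) (x a)) ->
  cvgC (fun i => \prod_(a <- r | D a) u i a) (\prod_(a <- r | D a) x a).
Proof.
move=> h; elim: r => [|a r IH].
  rewrite big_nil; have := cvgC_cst 1; congr cvgC.
  by apply/funext => i; rewrite big_nil.
rewrite big_cons.
have -> : (fun i => \prod_(a <- a :: r | D a) u i a) =
   (fun i => if D a then u i a * \prod_(a <- r | D a) u i a else \prod_(a <- r | D a) u i a).
  by apply/funext => i; rewrite big_cons.
by case: (D a) => //; exact: cvgCM.
Qed.

Lemma cvgC_unique u x y : cvgC u x -> cvgC u y -> x = y.
Proof.
move=> [ur ui] [vr vi]; apply/eqP; rewrite eq_complex; apply/andP; split; apply/eqP.
  exact: cvg_unique ur vr.
exact: cvg_unique ui vi.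
Qed.

Definition cvgM_entry p q (u : nat -> 'M[R[i]]_(p, q)) (x : 'M[R[i]]_(p, q)) :=
  forall a b, cvgC (fun i => u i a b) (x a b).

Lemma cvg_mxC p q (u : nat -> 'M[R[i]]_(p, q)) x : u @ \oo --> x <-> cvgM_entry u x.
Proof.
split=> [/cvg_matrix h a b|h]; first exact/cvg_complex/h.
by apply/cvg_matrix => a b; apply/cvg_complex.
Qed.

Lemma cvg_mxM p q r (u : nat -> 'M[R[i]]_(p, q)) (v : nat -> 'M[R[i]]_(q, r)) x y :
  cvgM_entry u x -> cvgM_entry v y -> cvgM_entry (fun i => u i *m v i) (x *m y).
Proof.
move=> hu hv a b; rewrite mxE.
have -> : (fun i => (u i *m v i) a b) = (fun i => \sum_j u i a j * v i j b).
  by apply/funext => i; rewrite mxE.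
by apply: cvgC_sum => j; apply: cvgCM.
Qed.

Lemma cvg_mx_adj p q (u : nat -> 'M[R[i]]_(p, q)) x :
  cvgM_entry u x -> cvgM_entry (fun i => (u i)^t*) (x^t*).
Proof.
move=> h a b; rewrite adjmxE.
have -> : (fun i => (u i)^t* a b) = (fun i => (u i b a)^*).
  by apply/funext => i; rewrite adjmxE.
exact: cvgC_conj.
Qed.

Lemma cvg_mx_cst p q (x : 'M[R[i]]_(p, q)) : cvgM_entry (fun=> x) x.
Proof. by move=> a b; exact: cvgC_cst. Qed.

Lemma cvg_mx_unique p q (u : nat -> 'M[R[i]]_(p, q)) x y :
  cvgM_entry u x -> cvgM_entry u y -> x = y.
Proof. by move=> hx hy; apply/matrixP => a b; apply: cvgC_unique (hx a b) (hy a b). Qed.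

Lemma cvg_mx_subseq p q (u : nat -> 'M[R[i]]_(p, q)) x phi :
  {homo phi : i j / (i < j)%N} -> cvgM_entry u x -> cvgM_entry (u \o phi) x.
Proof.
move=> hphi h a b; have [hr hi] := h a b.
by split; [exact: (cvg_subseq hphi hr)|exact: (cvg_subseq hphi hi)].
Qed.

Lemma cvg_retr p (u : nat -> 'M[R[i]]_p) x :
  cvgM_entry u x -> (fun i => retr (u i)) @ \oo --> retr x.
Proof.
move=> h; have [] // : cvgC (fun i => \tr (u i)) (\tr x).
by apply: cvgC_sum => a.
Qed.

Lemma cvg_stiefel p q (u : nat -> 'M[R[i]]_(p, q)) x :
  cvgM_entry u x -> (forall i, stiefel (u i)) -> stiefel x.
Proof.
move=> ux hu; apply: (@cvg_mx_unique _ _ (fun=> 1%:M)); last exact: cvg_mx_cst.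
have := cvg_mxM (cvg_mx_adj ux) ux.
by congr cvgM_entry; apply/funext => i; exact: hu.
Qed.

End Convergence.

(** * Compactness and continuity for tuples of factors *)

Section Factors.
Variables (R : realType) (m : nat) (n k : 'I_m -> nat).
Implicit Types (u : nat -> factors R n k) (x : factors R n k).

Definition cvgF u x := forall l, cvgM_entry (fun i => u i l) (x l).

Lemma cvg_factors u x : u @ \oo --> x <-> cvgF u x.
Proof.
split=> [/cvg_prod_topology h l|h]; first exact/cvg_mxC/h.
by apply/cvg_prod_topology => l; apply/cvg_mxC.
Qed.

Lemma cvg_factors_but_last (u : nat -> factors_but_last R n k) (x : factors_but_last R n k) :
  u @ \oo --> x <-> forall l, cvgM_entry (fun i => u i l) (x l).
Proof.
split=> [/cvg_prod_topology h l|h]; first exact/cvg_mxC/h.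
by apply/cvg_prod_topology => l; apply/cvg_mxC.
Qed.

Lemma cvgF_subseq u x phi :
  {homo phi : i j / (i < j)%N} -> cvgF u x -> cvgF (fun i => u (phi i)) x.
Proof. by move=> hphi h l; exact: (cvg_mx_subseq hphi (h l)). Qed.

(** Compactness of a product of Stiefel manifolds: the real and imaginary parts of all entries of
    all factors form one finite family of bounded real sequences. *)
Lemma stiefel_subseq u : (forall i l, stiefel (u i l)) ->
  exists2 phi : nat -> nat, {homo phi : i j / (i < j)%N} &
    exists x, cvgF (fun i => u (phi i)) x.
Proof.
move=> hu.
pose T : finType := {l : 'I_m & ('I_(n l) * 'I_(k l) * bool)%type}.
pose v (t : T) i : R := let: existT l (a, b, c) := t in
  if c then Re (u i l a b) else Im (u i l a b).
(* A bound common to all modes: with [S] the sum of the [k l], [|z|^2 <= k l <= S] and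
   [2 |z| <= 1 + |z|^2]. *)
have hb i l a b : normc (u i l a b) <= 1 + \sum_l (k l)%:R.
  have h1 : normc (u i l a b) ^+ 2 <= nsq (u i l).
    rewrite /nsq (bigD1 a) //= (bigD1 b) //= -addrA lerDl addr_ge0 //.
      by apply: sumr_ge0 => j _; exact: sqr_ge0.
    by apply: sumr_ge0 => j _; apply: sumr_ge0 => j' _; exact: sqr_ge0.
  have h2 : nsq (u i l) <= \sum_l (k l)%:R.
    rewrite nsq_stiefel // (bigD1 l) //= lerDl.
    by apply: sumr_ge0 => j _; exact: ler0n.
  have := sqr_ge0 (normc (u i l a b) - 1); have := normc_ge0 (u i l a b).
  move: (\sum_l _) (nsq _) (normc _) h1 h2 => S N z h1 h2 z0 h3; nra.
have [|phi hphi cphi] := @bounded_family_subseq R T v (1 + \sum_l (k l)%:R).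
  move=> [l [[a b] c]] i /=; apply: le_trans (hb i l a b).
  by case: c; [exact: normc_ge_Re|exact: normc_ge_Im].
exists phi => //.
pose lm (t : T) := limn (fun i => v t (phi i)).
exists (fun l => \matrix_(a, b) (lm (existT _ l (a, b, true)) +i* lm (existT _ l (a, b, false)))).
move=> l a b; rewrite mxE; split => /=.
  exact: (cphi (existT _ l (a, b, true))).
exact: (cphi (existT _ l (a, b, false))).
Qed.

Lemma cvg_gram u x l : cvgF u x ->
  cvgM_entry (fun i => u i l *m (u i l)^t*) (x l *m (x l)^t*).
Proof. by move=> h; apply: cvg_mxM (h l) (cvg_mx_adj (h l)). Qed.

Lemma cvg_Hmat (B : tensor R n) l u x : cvgF u x ->
  cvgM_entry (fun i => Hmat B l (u i)) (Hmat B l x).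
Proof.
move=> h a b; rewrite HmatE.
have -> : (fun i => Hmat B l (u i) a b) = (fun i =>
    \sum_(j : midx n | j l == a) \sum_(j' : midx n | j' l == b)
    B j * (B j')^* * \prod_(r | r != l) (u i r *m (u i r)^t*) (j' r) (j r)).
  by apply/funext => i; rewrite HmatE.
apply: cvgC_sum => j; apply: cvgC_sum => j'; apply: cvgCM; first exact: cvgC_cst.
by apply: cvgC_prod => r; exact: cvg_gram.
Qed.

Lemma cvg_objective (B : tensor R n) u x : cvgF u x ->
  (fun i => objective B (u i)) @ \oo --> objective B x.
Proof.
move=> h; have [] // : cvgC (fun i => (objective B (u i))%:C) (objective B x)%:C.
rewrite objectiveE.
have -> : (fun i => (objective B (u i))%:C) = (fun i =>
    \sum_j \sum_j' B j * (B j')^* * \prod_r (u i r *m (u i r)^t*) (j' r) (j r)).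
  by apply/funext => i; rewrite objectiveE.
apply: cvgC_sum => j; apply: cvgC_sum => j'; apply: cvgCM; first exact: cvgC_cst.
by apply: cvgC_prod => r; exact: cvg_gram.
Qed.

(** A real gauge of the product topology, so that leaving a neighbourhood becomes an inequality
    between reals. *)
Definition dist2 (y x : factors R n k) : R := \sum_(l < m) nsq (y l - x l).

Lemma cvg_sum_real (I : Type) (r : seq I) (u : nat -> I -> R) (x : I -> R) :
  (forall a, (fun i => u i a) @ \oo --> x a) ->
  (fun i => \sum_(a <- r) u i a) @ \oo --> \sum_(a <- r) x a.
Proof.
move=> h; elim: r => [|a r IH].
  by rewrite big_nil; under eq_cvg do rewrite big_nil; exact: cvg_cst.
by rewrite big_cons; under eq_cvg do rewrite big_cons; exact: cvgD.
Qed.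

Lemma cvg_dist2 u x y : cvgF u x -> (fun i => dist2 (u i) y) @ \oo --> dist2 x y.
Proof.
move=> h; apply: cvg_sum_real => l; rewrite /nsq.
apply: cvg_sum_real => a; apply: cvg_sum_real => b.
rewrite normc_sqrE; under eq_cvg do rewrite normc_sqrE.
have [hr hi] : cvgC (fun i => (u i l - y l) a b) ((x l - y l) a b).
  rewrite !mxE; have -> : (fun i => (u i l - y l) a b) = (fun i => u i l a b + (- y l a b)).
    by apply/funext => i; rewrite !mxE.
  by apply: cvgCD; [exact: h|exact: cvgC_cst].
by apply: cvgD; rewrite expr2; under eq_cvg do rewrite expr2; apply: cvgM.
Qed.

Lemma dist2_ge0 x y : 0 <= dist2 x y.
Proof. by apply: sumr_ge0 => l _; exact: nsq_ge0. Qed.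

Lemma dist2xx x : dist2 x x = 0.
Proof. by apply: big1 => l _; rewrite subrr nsq0. Qed.

Lemma cvgF_dist2 u x : (fun i => dist2 (u i) x) @ \oo --> 0 -> cvgF u x.
Proof.
move=> /cvgrPdist_lt h l a b.
have le i : normc (u i l a b - x l a b) ^+ 2 <= dist2 (u i) x.
  rewrite /dist2 (bigD1 l) //= -[leLHS]addr0 lerD //; last first.
    by apply: sumr_ge0 => ? _; exact: nsq_ge0.
  rewrite /nsq (bigD1 a) //= (bigD1 b) //= !mxE -addrA lerDl addr_ge0 //.
    by apply: sumr_ge0 => j _; exact: sqr_ge0.
  by apply: sumr_ge0 => j _; apply: sumr_ge0 => j' _; exact: sqr_ge0.
have key (e : R) : 0 < e -> \forall i \near \oo, normc (u i l a b - x l a b) < e.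
  move=> e0; have /h : 0 < e ^+ 2 by rewrite exprn_gt0.
  apply: filterS => i; rewrite sub0r normrN ger0_norm ?dist2_ge0 // => lt.
  by rewrite -(@ltr_pXn2r _ 2) ?nnegrE ?normc_ge0 ?ltW //; apply: le_lt_trans lt.
split; apply/cvgrPdist_lt => e /key; apply: filterS => i; apply: le_lt_trans.
  by rewrite distrC -raddfB normc_ge_Re.
by rewrite distrC -raddfB normc_ge_Im.
Qed.

(** Otherwise points outside [U] at squared distance at most [1 / (i + 1)] would converge to [x]. *)
Lemma dist2_nbhs (U : set (factors R n k)) x : nbhs x U ->
  exists2 e : R, 0 < e & forall y, dist2 y x <= e -> U y.
Proof.
move=> xU; apply: contrapT => hn.
have /choice[y hy] : forall i : nat, exists y, dist2 y x <= i.+1%:R^-1 /\ ~ U y.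
  move=> i; apply: contrapT => hy; apply: hn; exists i.+1%:R^-1.
    by rewrite invr_gt0 ltr0n.
  by move=> y yi; apply: contrapT => Uy; apply: hy; exists y.
have : cvgF y x.
  apply: cvgF_dist2; apply: (@squeeze_cvgr _ _ _ _ (fun=> 0) (@harmonic R)).
  - by near=> i; rewrite dist2_ge0 (hy i).1.
  - exact: cvg_cst.
  - exact: cvg_harmonic.
move=> /cvg_factors /(_ U xU) [N _ /(_ N)] /=.
by move=> /(_ (leqnn N)); have [] := hy N.
Unshelve. all: by end_near. Qed.

End Factors.

Section ExistsMaximizer.
Variables (R : realType) (n k : nat) (A : 'M[R[i]]_n).

(** The first [k] eigenvectors, whose weights are exactly the indicator of [i < k]. This is the
    fixed competitor against which a limit of maximizers is tested. *)
Lemma exists_maximizer : hermitian A -> (k <= n)%N ->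
  exists X : 'M[R[i]]_(n, k), maximizer A X.
Proof.
move=> hA kn; have [V [V1 V2 AE]] := hermitian_spectral hA.
pose E : 'M[R[i]]_(n, k) := \matrix_(i, j) (i == j :> nat)%:R.
have EE : E^t* *m E = 1%:M.
  apply/matrixP => a b; rewrite mxE (bigD1 (widen_ord kn a)) //= big1.
    by rewrite !mxE /= eqxx rmorph_nat mul1r addr0.
  move=> i ia; rewrite !mxE rmorph_nat (_ : (i == a :> nat) = false) ?mul0r //.
  by apply/negbTE.
have VE : V^t* *m (V *m E) = E by rewrite mulmxA V1 mul1mx.
exists (V *m E); split.
  by rewrite /stiefel adjmxM -mulmxA VE EE.
rewrite (retr_rayleigh AE) VE /topsum (sum_ord_lt (fun i => lambda A i.+1) kn).
apply: eq_bigr => i _; congr (_ * _); rewrite /weight.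
case: ltnP => ik.
  rewrite (bigD1 (Ordinal ik)) //= big1 => [|j ji].
    by rewrite mxE eqxx Normc.normc1 expr1n addr0.
  rewrite mxE (_ : (i == j :> nat) = false) ?Normc.normc0 ?expr0n //.
  by apply: contraNF ji => /eqP e; apply/eqP/val_inj.
apply: big1 => j _; rewrite mxE (_ : (i == j :> nat) = false) ?Normc.normc0 ?expr0n //.
by apply/negbTE; rewrite gtn_eqF // (leq_trans (ltn_ord j)).
Qed.

End ExistsMaximizer.

(** * The iteration *)

Section Hooi.
Variables (R : realType) (m : nat) (n k : 'I_m -> nat).
Hypothesis hk : forall l, (1 <= k l <= n l)%N.
Variables (B : tensor R n) (P : nat -> factors R n k).
Hypothesis hP : hooi B P.

Let k0 l : (0 < k l)%N. Proof. by case/andP: (hk l). Qed.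
Let kn l : (k l <= n l)%N. Proof. by case/andP: (hk l). Qed.

Lemma hooi_stiefel j l : stiefel (P j l).
Proof. by case: j => [|j]; [apply: hP.1|have [] := hP.2 j l]. Qed.

Lemma hooi_maximizer j l : maximizer (Hseq B P j l) (P j.+1 l).
Proof. exact/top_eigenvectors_maximizer/hP.2. Qed.

(** The state of a sweep from [X] to [Y] when the modes below [t] have been updated. It is [before]
    with a natural number as index, so that [t = m] is allowed and the states interpolate from [X]
    to [Y]. *)
Definition mixed (X Y : factors R n k) (t : nat) : factors R n k :=
  fun r => if (r < t)%N then Y r else X r.

Lemma mixed0 X Y : mixed X Y 0 = X.
Proof. by apply: functional_extensionality_dep => r; rewrite /mixed ltn0. Qed.

Lemma mixed_full X Y : mixed X Y m = Y.
Proof. by apply: functional_extensionality_dep => r; rewrite /mixed ltn_ord. Qed.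

Lemma objective_mixed X Y (l : 'I_m) :
  objective B (mixed X Y l) = retr (rayleigh (Hmat B l (before l Y X)) (X l)).
Proof. by rewrite (objective_rayleigh B l) /mixed ltnn. Qed.

Lemma objective_mixedS X Y (l : 'I_m) :
  objective B (mixed X Y l.+1) = retr (rayleigh (Hmat B l (before l Y X)) (Y l)).
Proof.
have E : Hmat B l (mixed X Y l.+1) = Hmat B l (before l Y X).
  apply: Hmat_gram => r rl; rewrite /mixed /before ltnS leq_eqVlt.
  by have -> : (r == l :> nat) = false by apply/negbTE.
have e : mixed X Y l.+1 l = Y l by rewrite /mixed ltnSn.
by rewrite (objective_rayleigh B l) E e.
Qed.

Lemma objective_step j (l : 'I_m) :
  objective B (mixed (P j) (P j.+1) l) <= objective B (mixed (P j) (P j.+1) l.+1).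
Proof.
rewrite objective_mixed objective_mixedS.
apply: retr_rayleigh_le_maximizer => //; first exact: hermitian_Hmat.
  exact: hooi_maximizer.
exact: hooi_stiefel.
Qed.

Lemma objective_mixed_homo j s t : (s <= t <= m)%N ->
  objective B (mixed (P j) (P j.+1) s) <= objective B (mixed (P j) (P j.+1) t).
Proof.
move=> /andP[]; elim: t => [|t IH]; first by rewrite leqn0 => /eqP ->.
rewrite leq_eqVlt => /orP[/eqP -> //|]; rewrite ltnS => st tm.
by apply: le_trans (IH st (ltnW tm)) _; exact: (objective_step j (Ordinal tm)).
Qed.

Lemma objective_nondecreasing : nondecreasing_seq (fun j => objective B (P j)).
Proof.
apply/nondecreasing_seqP => j.
by have := @objective_mixed_homo j 0 m; rewrite mixed0 mixed_full leqnn; apply.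
Qed.

Lemma objective_mixed_between j t : (t <= m)%N ->
  objective B (P j) <= objective B (mixed (P j) (P j.+1) t) <= objective B (P j.+1).
Proof.
move=> tm; apply/andP; split.
  by rewrite -{1}(mixed0 (P j) (P j.+1)) objective_mixed_homo.
by rewrite -{2}(mixed_full (P j) (P j.+1)) objective_mixed_homo // tm leqnn.
Qed.

Section AtAccumulation.
Variables (N : nat -> nat) (X : factors R n k).
Hypothesis hN : {homo N : i j / (i < j)%N}.
Hypothesis NX : cvgF (fun i => P (N i)) X.

(** The bound on the objective comes from the accumulation point itself: a nondecreasing sequence
    stays below the limit of any of its subsequences. *)
Lemma objective_le_accumulation j : objective B (P j) <= objective B X.
Proof.
have sub : (fun i => objective B (P (N i))) @ \oo --> objective B X by exact: cvg_objective.
apply: (cvgr_to_ge sub); exists j => // i /= ji.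
by apply: objective_nondecreasing; exact: leq_trans ji (leq_subseq hN i).
Qed.

Lemma cvg_objective_accumulation : (fun j => objective B (P j)) @ \oo --> objective B X.
Proof.
have ub : has_ubound (range (fun j => objective B (P j))).
  by exists (objective B X) => _ [j _ <-]; exact: objective_le_accumulation.
have c := nondecreasing_cvgn objective_nondecreasing ub.
by rewrite (cvg_unique _ (cvg_objective (B := B) NX) (cvg_subseq hN c)).
Qed.

Variable Y : factors R n k.
Hypothesis NY : cvgF (fun i => P (N i).+1) Y.

Lemma cvg_mixed t : cvgF (fun i => mixed (P (N i)) (P (N i).+1) t) (mixed X Y t).
Proof. by move=> r; rewrite /mixed; case: (r < t)%N; [exact: NY|exact: NX]. Qed.

(** The intermediate objectives are squeezed between those at [N i] and at [(N i).+1], and the whole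
    sequence of objectives converges to [objective B X]. *)
Lemma objective_mixed_limit t : (t <= m)%N -> objective B (mixed X Y t) = objective B X.
Proof.
move=> tm; have ct := cvg_objective (B := B) (cvg_mixed t).
suff : (fun i => objective B (mixed (P (N i)) (P (N i).+1) t)) @ \oo --> objective B X.
  exact: cvg_unique ct.
have cf := cvg_objective_accumulation.
have hN1 : {homo (fun i => (N i).+1) : i j / (i < j)%N} by move=> i j ij; rewrite ltnS hN.
apply: (squeeze_cvgr _ (cvg_subseq hN cf) (cvg_subseq hN1 cf)).
by near=> i; exact: objective_mixed_between.
Unshelve. all: by end_near. Qed.

Lemma cvg_rayleigh p q (A : nat -> 'M[R[i]]_p) A' (Z : nat -> 'M[R[i]]_(p, q)) Z' :
  cvgM_entry A A' -> cvgM_entry Z Z' ->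
  (fun i => retr (rayleigh (A i) (Z i))) @ \oo --> retr (rayleigh A' Z').
Proof.
by move=> hA hZ; exact: (cvg_retr (cvg_mxM (cvg_mxM (cvg_mx_adj hZ) hA) hZ)).
Qed.

(** Each new factor beats a fixed maximizer [Z] of the limit matrix, tested against the current
    [H_l]; in the limit [Y l] does at least as well as [Z]. *)
Lemma limit_maximizer l :
  maximizer (Hmat B l (before l Y X)) (X l) /\ maximizer (Hmat B l (before l Y X)) (Y l).
Proof.
set A := Hmat B l (before l Y X).
have hA : hermitian A by exact: hermitian_Hmat.

have sX : stiefel (X l) := cvg_stiefel (@NX l) (fun i => hooi_stiefel (N i) l).
have sY : stiefel (Y l) := cvg_stiefel (@NY l) (fun i => hooi_stiefel (N i).+1 l).
have [Z mZ] := exists_maximizer hA (kn l).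
have le : retr (rayleigh A Z) <= retr (rayleigh A (Y l)).
  have cA : cvgM_entry (fun i => Hseq B P (N i) l) A := cvg_Hmat B (l := l) (cvg_mixed l).
  have c1 := cvg_rayleigh cA (cvg_mx_cst Z).
  have c2 := cvg_rayleigh cA (@NY l).
  apply: (ler_cvg_to c1 c2); apply: nearW => i.
  exact: (retr_rayleigh_le_maximizer (hermitian_Hmat B l _) (k0 l) (kn l)
    (hooi_maximizer (N i) l) mZ.1).
have mY := maximizer_of_ge hA (k0 l) (kn l) mZ sY le.
(* The objectives of the states just before and just after the update of mode [l] agree in the
   limit, so [X l] reaches the same trace as [Y l]. *)
split=> //; apply: (maximizer_of_ge hA (k0 l) (kn l) mY sX).
by rewrite -objective_mixedS -objective_mixed !objective_mixed_limit // ltnW.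
Qed.

Lemma stiefel_gram p q (U : 'M[R[i]]_(p, q)) (Q : 'M[R[i]]_q) : stiefel Q ->
  (U *m Q) *m (U *m Q)^t* = U *m U^t*.
Proof.
by move=> /mulmx1C hQ; rewrite adjmxM mulmxA -[_ *m Q *m _]mulmxA hQ mulmx1.
Qed.

(** Strong induction on the mode: once the earlier factors differ by unitary matrices, the matrix
    maximized by [X l] and [Y l] is [H_l] at [X], whose gap is the one assumed. The bound [t] is
    [m.-1] for (c) and [m] for (d). *)
Lemma limit_unitary t : (forall l : 'I_m, (l < t)%N -> gap_pos (Hmat B l X) (k l)) ->
  forall l : 'I_m, (l < t)%N -> exists2 Q, stiefel Q & Y l = X l *m Q.
Proof.
move=> hg l; have [s] := ubnP (nat_of_ord l); elim: s l => // s IH l.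
rewrite ltnS => ls lt; have [mX mY] := limit_maximizer l.
have E : Hmat B l (before l Y X) = Hmat B l X.
  apply: Hmat_gram => r _; rewrite /before; case: ltnP => // rl.
  by have [Q hQ ->] := IH r (leq_trans rl ls) (ltn_trans rl lt); rewrite stiefel_gram.
rewrite E in mX mY.
exact: (maximizer_unique (hermitian_Hmat B l X) (k0 l) (kn l) mX mY (hg l lt)).
Qed.

(** The bound is [l <= t] because only modes strictly before [l] are compared; with gaps on the
    modes below [m.-1], this reaches the last mode in (c). *)
Lemma limit_Hmat t : (forall l : 'I_m, (l < t)%N -> gap_pos (Hmat B l X) (k l)) ->
  forall l : 'I_m, (l <= t)%N -> Hmat B l (before l Y X) = Hmat B l X.
Proof.
move=> hg l lt; apply: Hmat_gram => r _; rewrite /before; case: ltnP => // rl.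
by have [Q hQ ->] := limit_unitary hg (leq_trans rl lt); rewrite stiefel_gram.
Qed.

End AtAccumulation.
End Hooi.

(** * Isolated accumulation points *)

Section PolarLimit.
Variable R : realType.

Lemma psd_retr p q (G : 'M[R[i]]_p) (E : 'M[R[i]]_(p, q)) :
  psd G -> 0 <= retr (E^t* *m G *m E).
Proof.
move=> [_ hG]; rewrite /retr /mxtrace raddf_sum; apply: sumr_ge0 => a _ /=.
have := hG (col a E).
have -> : ((col a E)^t* *m G *m col a E) ord0 ord0 = (E^t* *m G *m E) a a.
  rewrite -!mulmxA !mxE; apply: eq_bigr => b _; rewrite !mxE; congr (_ * _).
  by apply: eq_bigr => c _; rewrite !mxE.
by rewrite lecE => /andP[].
Qed.

(* A positive semidefinite unitary [G] satisfies [(G + 1) (G - 1) = 0]. *)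
Lemma unitary_psd_limit p (g : nat -> 'M[R[i]]_p) (G : 'M[R[i]]_p) :
  (forall i, psd (g i)) -> cvgM_entry g G -> stiefel G -> G = 1%:M.
Proof.
move=> hg gG sG.
have hG : G^t* = G.
  apply: (@cvg_mx_unique _ _ _ g) => //.
  by have := cvg_mx_adj gG; congr cvgM_entry; apply/funext => i; case: (hg i).
pose E := G - 1%:M.
have GE : G *m E = - E.
  by rewrite /E mulmxBr mulmx1 -{1}hG sG opprB.
have nn : 0 <= retr (E^t* *m G *m E).
  have c : (fun i => retr (E^t* *m g i *m E)) @ \oo --> retr (E^t* *m G *m E).
    exact: (cvg_retr (cvg_mxM (cvg_mxM (cvg_mx_cst _) gG) (cvg_mx_cst _))).
  by apply: (cvgr_to_ge c); exists 0%N => // i _; exact: psd_retr.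
have : nsq E = 0.
  (* As [G E = - E], the nonnegative number [nn] is also [- nsq E]. *)
  apply/eqP; rewrite eq_le nsq_ge0 andbT -oppr_ge0; apply: le_trans nn _.
  rewrite -mulmxA GE mulmxN /retr linearN /= raddfN /= mxtrace_mulC -nsqE.
  by [].
by move/nsq_eq0/eqP; rewrite subr_eq0 => /eqP.
Qed.

(** [Q^H (Y^H X)] is a limit of the positive semidefinite polar parts and a product of unitary
    matrices, hence the identity. *)
Lemma polar_factor_limit n k (X : 'M[R[i]]_(n, k)) (Y : 'M[R[i]]_(n, k)) u q Q :
  (forall i : nat, polar_factor ((u i)^t* *m X) (q i)) ->
  cvgM_entry u Y -> cvgM_entry q Q -> stiefel (Y^t* *m X) -> Q = Y^t* *m X.
Proof.
move=> hq uY qQ sU.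
have sq i : stiefel (q i) by case: (hq i).
have sQ : stiefel Q by exact: cvg_stiefel qQ sq.
have sQ' : Q *m Q^t* = 1%:M by exact: mulmx1C.
have G1 : Q^t* *m (Y^t* *m X) = 1%:M.
  apply: (@unitary_psd_limit _ (fun i => (q i)^t* *m ((u i)^t* *m X))).
  - by move=> i; have [_ [G psdG ->]] := hq i; rewrite mulmxA sq mul1mx.
  - exact: (cvg_mxM (cvg_mx_adj qQ) (cvg_mxM (cvg_mx_adj uY) (cvg_mx_cst _))).
  - move: (Y^t* *m X) sU => U sU.
    by rewrite /stiefel adjmxM trmxCK mulmxA -[_ *m Q *m _]mulmxA sQ' mulmx1.
by rewrite -[LHS]mulmx1 -G1 [LHS]mulmxA sQ' mul1mx.
Qed.

End PolarLimit.

Section Isolated.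
Variables (R : realType) (m : nat) (n k : 'I_m -> nat).
Hypothesis hk : forall l, (1 <= k l <= n l)%N.
Variables (B : tensor R n) (P : nat -> factors R n k).
Hypothesis hP : hooi B P.
Variable Ps : factors R n k.
Hypothesis sPs : forall l, stiefel (Ps l).
Hypothesis gaps : forall l, gap_pos (Hmat B l Ps) (k l).
Variable Q : nat -> forall l, 'M[R[i]]_(k l).
Hypothesis hQ : forall j l, polar_factor ((P j l)^t* *m Ps l) (Q j l).

Let PQ : nat -> factors R n k := fun j l => P j l *m Q j l.

Let sQ j l : stiefel (Q j l). Proof. by case: (hQ j l). Qed.

Lemma stiefelM p q (U : 'M[R[i]]_(p, q)) (V : 'M[R[i]]_q) :
  stiefel U -> stiefel V -> stiefel (U *m V).
Proof. by move=> hU hV; rewrite /stiefel adjmxM mulmxA -[_ *m U^t* *m U]mulmxA hU mulmx1. Qed.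

(** Four extractions make the iterates, their successors and both sequences of polar factors
    converge. The positive gaps make the limit of the successors span the ranges of [Ps], and then
    the limiting alignment is exact. *)
Lemma polar_step N : {homo N : i j / (i < j)%N} -> cvgF (fun i => PQ (N i)) Ps ->
  exists2 psi : nat -> nat, {homo psi : i j / (i < j)%N} &
    cvgF (fun i => PQ (N (psi i)).+1) Ps.
Proof.
move=> hN NPs.
have [f1 hf1 [X c1]] := stiefel_subseq (fun i l => hooi_stiefel hP (N i) l).
have [f2 hf2 [Qx c2]] := @stiefel_subseq R m k k (fun i => Q (N (f1 i))) (fun i l => sQ _ l).
have [f3 hf3 [Y c3]] := stiefel_subseq (fun i l => hooi_stiefel hP (N (f1 (f2 i))).+1 l).
have [f4 hf4 [Qy c4]] := @stiefel_subseq R m k k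
  (fun i => Q (N (f1 (f2 (f3 i)))).+1) (fun i l => sQ _ l).
pose psi i := f1 (f2 (f3 (f4 i))).
have hpsi : {homo psi : i j / (i < j)%N} by move=> i j ij; rewrite /psi hf1 ?hf2 ?hf3 ?hf4.
have cX : cvgF (fun i => P (N (psi i))) X.
  exact: (cvgF_subseq hf4 (cvgF_subseq hf3 (cvgF_subseq hf2 c1))).
have cQx : cvgF (fun i => (Q (N (psi i)) : factors R k k)) Qx.
  exact: (cvgF_subseq hf4 (cvgF_subseq hf3 c2)).
have cY : cvgF (fun i => P (N (psi i)).+1) Y := cvgF_subseq hf4 c3.
have sQx l : stiefel (Qx l) := cvg_stiefel (cQx l) (fun i => sQ (N (psi i)) l).
have cPs : cvgF (fun i => PQ (N (psi i))) Ps := cvgF_subseq hpsi NPs.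
(* The limit [X] of the raw iterates may differ from [Ps], but only by unitary factors, so it has
   the same matrices [H_l] and the same gaps. *)
have XQ l : X l *m Qx l = Ps l.
  apply: cvg_mx_unique (cvg_mxM (cX l) (cQx l)) _.
  exact: (cPs l).
have gX l : X l *m (X l)^t* = Ps l *m (Ps l)^t* by rewrite -XQ stiefel_gram.
have HX l : Hmat B l X = Hmat B l Ps by apply: Hmat_gram => r _; exact: gX.
have hNpsi : {homo (fun i => N (psi i)) : i j / (i < j)%N}.
  by move=> i j ij; rewrite hN ?hpsi.
have YX l : exists2 W, stiefel W & Y l = X l *m W.
  apply: (limit_unitary hk hP hNpsi cX cY (t := m)) => // l' _.
  by rewrite HX; exact: gaps.
exists psi => // l.
have sY : stiefel (Y l) := cvg_stiefel (cY l) (fun i => hooi_stiefel hP (N (psi i)).+1 l).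
have YP : Y l *m (Y l)^t* = Ps l *m (Ps l)^t*.
  by have [W sW ->] := YX l; rewrite stiefel_gram.
have U : stiefel ((Y l)^t* *m Ps l).
  rewrite /stiefel adjmxM trmxCK mulmxA -[_ *m Y l *m _]mulmxA YP.
  by rewrite !mulmxA sPs mul1mx sPs.
have QyE : Qy l = (Y l)^t* *m Ps l.
  by apply: (polar_factor_limit (fun i => hQ (N (psi i)).+1 l) (cY l) (c4 l)).
have := cvg_mxM (cY l) (c4 l).
by rewrite QyE mulmxA YP -mulmxA sPs mulmx1.
Qed.

Lemma frequently_subseq (C : nat -> Prop) : (forall s, exists2 j, (s <= j)%N & C j) ->
  exists2 N : nat -> nat, {homo N : i j / (i < j)%N} & forall i, C (N i).
Proof.
move=> h; have /choice[f hf] : forall s, exists j, (s <= j)%N /\ C j.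
  by move=> s; have [j] := h s; exists j.
pose N := fix N i := if i is i'.+1 then f (N i').+1 else f 0%N.
exists N; last by case=> [|i]; exact: (hf _).2.
by apply: homo_ltn => [? ? ?|i]; [exact: ltn_trans|exact: (hf _).1].
Qed.

(** Without convergence, the aligned iterates are infinitely often in a small ball around [Ps] and
    infinitely often outside, so infinitely many single steps leave the ball. The starting points of
    such steps accumulate only at [Ps], and [polar_step] then brings some of their endpoints back
    into the ball. *)
Lemma isolated_polar_cvg : isolated_accumulation_point PQ Ps -> PQ @ \oo --> Ps.
Proof.
move=> [[phi hphi /cvg_factors cphi] [U nU hU]].
have [e e0 he] := dist2_nbhs nU.
apply/cvg_factors/cvgF_dist2/cvgrPdist_lt => d d0; apply: contrapT => hn.
(* The bound [e] keeps the closed ball inside [U]; halving [d] turns [g j <= d'] into the strict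
   inequality of the limit. *)
pose d' := Num.min (d / 2) e.
have d'0 : 0 < d' by rewrite lt_min e0 divr_gt0.
pose g j := dist2 (PQ j) Ps.
have far s : exists2 j, (s <= j)%N & d' < g j.
  apply: contrapT => h; apply: hn; exists s => // j /= sj.
  rewrite sub0r normrN ger0_norm ?dist2_ge0 //.
  have : g j <= d' by rewrite leNgt; apply/negP => gj; apply: h; exists j.
  move/le_lt_trans; apply; rewrite gt_min; apply/orP; left.
  by rewrite ltr_pdivrMr // ltr_pMr // ltr1n.
have near s : exists2 j, (s <= j)%N & g j <= d'.
  have := cvg_dist2 (y := Ps) cphi; rewrite dist2xx => /cvgrPdist_lt /(_ d' d'0) [N _ hN].
  exists (phi (maxn s N)); first by rewrite (leq_trans (leq_maxl s N)) // leq_subseq.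
  have := hN (maxn s N) (leq_maxr s N).
  by rewrite /= sub0r normrN ger0_norm ?dist2_ge0 // => /ltW.
(* If no step after a visit to the ball left it, all later iterates would stay inside, against
   [far]. *)
have cross s : exists2 j, (s <= j)%N & g j <= d' /\ d' < g j.+1.
  have [j0 sj0 gj0] := near s; have [j1 j01 gj1] := far j0.
  apply: contrapT => h.
  have all i : g (j0 + i)%N <= d'.
    elim: i => [|i IH]; first by rewrite addn0.
    rewrite leNgt; apply/negP => gi; apply: h; exists (j0 + i)%N.
      exact: leq_trans sj0 (leq_addr _ _).
    by rewrite -addnS.
  by have := all (j1 - j0)%N; rewrite subnKC // leNgt gj1.
have [N hN NC] := frequently_subseq cross.
have sPQ i l : stiefel (PQ i l) by apply: stiefelM => //; exact: (hooi_stiefel hP).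
have [chi hchi [y cy]] := stiefel_subseq (fun i l => sPQ (N i) l).
have yPs : y = Ps.
  (* The limit of starting points remains in the closed ball, hence in [U], and isolation
     applies. *)
  apply: hU.
    apply: he; apply: (@le_trans _ _ d'); last by rewrite ge_min lexx orbT.
    apply: (cvgr_to_le (cvg_dist2 (y := Ps) cy)); exists 0%N => // i _.
    by case: (NC (chi i)).
  exists (N \o chi); first exact: homo_ltn_comp.
  exact/cvg_factors.
rewrite yPs in cy.
have [psi hpsi cpsi] := polar_step (homo_ltn_comp hN hchi) cy.
have := cvg_dist2 (y := Ps) cpsi; rewrite dist2xx => /cvgrPdist_lt /(_ d' d'0) [s _ /(_ s)].
rewrite /= leqnn => /(_ isT); rewrite sub0r normrN ger0_norm ?dist2_ge0 //.
by rewrite ltNge ltW //; case: (NC (chi (psi s))).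
Qed.

End Isolated.

(** * Convergence of the series *)

Section Series.
Variable R : realType.

Lemma cvg_series_telescope (t f : nat -> R) (c M : R) : 0 <= c ->
  (forall j, 0 <= t j <= c * (f j.+1 - f j)) -> (forall j, f j <= M) ->
  cvgn (series t).
Proof.
move=> c0 ht hf; apply: nondecreasing_is_cvgn.
  apply/nondecreasing_seqP => j; rewrite /series /= big_nat_recr //= lerDl.
  by case/andP: (ht j).
exists (c * (M - f 0%N)) => _ [j _ <-].
have : series t j <= c * (f j - f 0%N).
  elim: j => [|j IH]; first by rewrite /series /= big_geq // subrr mulr0.
  rewrite /series /= big_nat_recr //=.
  have /andP[_ h] := ht j; apply: le_trans (lerD IH h) _.
  by rewrite -mulrDr (_ : f j - f 0%N + (f j.+1 - f j) = f j.+1 - f 0%N) //; ring.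
by move/le_trans; apply; rewrite ler_wpM2l // lerD2r.
Qed.

End Series.

Section HooiSeries.
Variables (R : realType) (m : nat) (n k : 'I_m -> nat).
Hypothesis hk : forall l, (1 <= k l <= n l)%N.
Variables (B : tensor R n) (P : nat -> factors R n k).
Hypothesis hP : hooi B P.
Variable M : R.
Hypothesis hM : forall j, objective B (P j) <= M.
Variable l : 'I_m.
Hypothesis kn : (k l < n l)%N.

Let k0 : (0 < k l)%N. Proof. by case/andP: (hk l). Qed.

(** The gap bounds the increase due to the update of mode [l] alone, which is part of the increase
    over the whole sweep. *)
Lemma gap_sin_theta_le j :
  0 <= gap (Hseq B P j l) (k l) * sin_theta (P j.+1 l) (P j l) ^+ 2 <=
  objective B (P j.+1) - objective B (P j).
Proof.
have hH := hermitian_Hmat B l (before l (P j.+1) (P j)).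
rewrite mulr_ge0 ?sqr_ge0 ?gap_ge0 //= sin_theta_sqr; last 2 first.
- exact: (hooi_stiefel hP).
- exact: (hooi_stiefel hP).
apply: le_trans (gap_mul_nsq_le hH k0 (ltnW kn) (hooi_maximizer hP j l) (hooi_stiefel hP j l) kn) _.
rewrite -objective_mixedS -objective_mixed.
have /andP[_ h1] := objective_mixed_between hk hP j (ltn_ord l).
have /andP[h2 _] := objective_mixed_between hk hP j (ltnW (ltn_ord l)).
exact: lerB.
Qed.

Lemma cvg_series_sin_theta : cvgn (series (fun j =>
  gap (Hseq B P j l) (k l) * sin_theta (P j.+1 l) (P j l) ^+ 2)).
Proof.
apply: (@cvg_series_telescope _ _ (fun j => objective B (P j)) 1 M) => // j.
by rewrite mul1r gap_sin_theta_le.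
Qed.

Lemma cvg_series_residual : cvgn (series (fun j => let Hj := Hseq B P j l in
  gap Hj (k l) * (fro_mx (Hj *m P j l - P j l *m rayleigh Hj (P j l)) ^+ 2
    / fro_mx Hj ^+ 2))).
Proof.
apply: (@cvg_series_telescope _ _ (fun j => objective B (P j)) 4 M) => // j /=.
set A := Hseq B P j l.
have hA : hermitian A := hermitian_Hmat B l (before l (P j.+1) (P j)).
have g0 : 0 <= gap A (k l) by exact: gap_ge0.
have mX := hooi_maximizer hP j l.
have [AX _ _] := maximizer_eigenspace hA k0 (ltnW kn) mX.
rewrite !fro_mx_sqr mulr_ge0 ?divr_ge0 ?nsq_ge0 //=.
have := nsq_residual_le hA (hooi_stiefel hP j.+1 l) (hooi_stiefel hP j l) AX.
rewrite -sin_theta_sqr; [|exact: (hooi_stiefel hP)|exact: (hooi_stiefel hP)].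
have /andP[_] := gap_sin_theta_le j; rewrite -/A.
move: (sin_theta _ _ ^+ 2) (sqr_ge0 (sin_theta (P j.+1 l) (P j l))) => s s0 hs hr.
apply: (@le_trans _ _ (4 * (gap A (k l) * s))); last by rewrite ler_pM2l.
(* If the matrix is 0, the quotient is 0 because the inverse of 0 is 0. *)
rewrite [leRHS]mulrCA ler_wpM2l //; have := nsq_ge0 A; rewrite le_eqVlt => /orP[/eqP e|A0].
  by rewrite -e invr0 mulr0 mulr_ge0.
by rewrite ler_pdivrMr // mulrAC.
Qed.

End HooiSeries.

Lemma with_lastE (R : realType) (m : nat) (n k : 'I_m -> nat)
    (X : factors_but_last R n k) (Y : factors R n k) (r : 'I_m) (h : (r < m.-1)%N) :
  with_last X Y r = X (exist _ r h).
Proof.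
rewrite /with_last.
(* The match is generalized over its boolean index; in the true branch the two proofs of [r < m.-1]
   are identified by irrelevance. *)
refine (match @idP (r < m.-1)%N as q in reflect _ b return
  match q with ReflectT h' => X (exist _ r h') | ReflectF _ => Y r end =
    X (exist _ r h) with ReflectT h' => _ | ReflectF nh => _ end).
  by rewrite (bool_irrelevance h' h).
by case: nh.
Qed.

Unset Implicit Arguments.

Theorem theorem4p1 (R : realType) (m : nat) (hm : (2 <= m)%N)
    (n k : 'I_m -> nat) (hk : forall l, (1 <= k l <= n l)%N)
    (B : tensor R n) (P : nat -> factors R n k) (hP : hooi B P)
    (* the increasing enumeration of the index set of the subsequence *)
    (phi : nat -> nat) (hphi : {homo phi : i j / (i < j)%N})
    (Ps : factors R n k) (hPs : (fun i => P (phi i)) @ \oo --> Ps)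
    (Ph : factors_but_last R n k)
    (hPh : accumulation_point (fun i => drop_last (P (phi i).+1)) Ph) :
  let H l := Hmat B l Ps in
  let Hh l := Hmat B l (before l (with_last Ph Ps) Ps) in
  let gaps := forall l : 'I_m, (l < m.-1)%N -> gap_pos (H l) (k l) in
  [/\ (* (a) *)
      nondecreasing_seq (fun j => objective B (P j)) /\
      cvgn (fun j => objective B (P j)),
      (* (b) *)
      forall l, top_eigenspace_eq (Hh l) (Ps l),
      (* (c) *)
      gaps ->
        (forall l : mode_but_last m, exists2 Q : 'M[R[i]]_(k (sval l)),
           stiefel Q & Ph l = Ps (sval l) *m Q) /\
        (forall l, top_eigenspace_eq (H l) (Ps l)),
      (* (d) *)
      forall Q : nat -> forall l, 'M[R[i]]_(k l),
        (forall j l, polar_factor ((P j l)^t* *m Ps l) (Q j l)) ->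
        let PQ : nat -> factors R n k := fun j l => P j l *m Q j l in
        isolated_accumulation_point PQ Ps ->
        gaps ->
        (forall l : 'I_m, l = m.-1 :> nat -> gap_pos (H l) (k l)) ->
        PQ @ \oo --> Ps
    & (* (e) *)
      forall l, (k l < n l)%N ->
        cvgn (series (fun j =>
          gap (Hseq B P j l) (k l) * sin_theta (P j.+1 l) (P j l) ^+ 2)) /\
        (* x / 0 = 0 here, so that a term with Hseq B P j l = 0 is 0 *)
        cvgn (series (fun j =>
          let Hj := Hseq B P j l in
          gap Hj (k l) *
            (fro_mx (Hj *m P j l - P j l *m rayleigh Hj (P j l)) ^+ 2
             / fro_mx Hj ^+ 2)))].
Proof.
have cPs : cvgF (fun i => P (phi i)) Ps by exact/cvg_factors.
have sPs l : stiefel (Ps l) := cvg_stiefel (cPs l) (fun i => hooi_stiefel hP (phi i) l).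
have hM := objective_le_accumulation hk hP hphi cPs.
have [psi hpsi /cvg_factors_but_last cPh] := hPh.
(* [Ph] carries no last mode. A further extraction makes the complete successor converge to some
   [Y], which agrees with [Ph] on the other modes. *)
have [chi hchi [Y NY]] :=
  stiefel_subseq (fun i l => hooi_stiefel hP (phi (psi i)).+1 l).
pose N i := phi (psi (chi i)).
have hN : {homo N : i j / (i < j)%N} by move=> i j ij; rewrite /N hphi ?hpsi ?hchi.
have NX : cvgF (fun i => P (N i)) Ps := cvgF_subseq hchi (cvgF_subseq hpsi cPs).
have YPh l : Ph l = Y (sval l).
  exact: (cvg_mx_unique (cvg_mx_subseq hchi (cPh l)) (NY (sval l))).
have hl (l : 'I_m) : (l <= m.-1)%N by rewrite -ltnS (ltn_predK hm).
move=> H Hh gaps.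
(* Only modes before [l] are taken from the successor, and none of them is the last one; there
   [with_last Ph Ps] and [Y] coincide. *)
have HhE l : Hh l = Hmat B l (before l Y Ps).
  apply: Hmat_gram => r _; rewrite /before; case: ltnP => // rl.
  have rm : (r < m.-1)%N := leq_trans rl (hl l).
  by rewrite (with_lastE _ _ rm) YPh.
have bP l : top_eigenspace_eq (Hh l) (Ps l).
  rewrite HhE; have [k0 kn] := andP (hk l).
  apply: (maximizer_eigenspace (hermitian_Hmat B l _) k0 kn).
  by case: (limit_maximizer hk hP hN NX NY l).
split.
- split; first exact: objective_nondecreasing.
  exact: cvgP (cvg_objective_accumulation hk hP hphi cPs).
- exact: bP.
- move=> hg; split=> l.
    rewrite YPh; apply: (limit_unitary hk hP hN NX NY (t := m.-1)) => //.
    exact: (svalP l).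
  have := bP l; rewrite HhE.
  by rewrite (limit_Hmat hk hP hN NX NY hg (hl l)).
- move=> Q hQ PQ iso hg hg'.
  apply: (isolated_polar_cvg hk hP sPs _ hQ iso) => l.
  have := hl l; rewrite leq_eqVlt => /orP[/eqP|]; first exact: hg'.
  exact: hg.
- move=> l kn; split.
    exact: (cvg_series_sin_theta hk hP hM kn).
  exact: (cvg_series_residual hk hP hM kn).
Qed.
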